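(* For every $n\ge1$ and $p\ge0$ there is an isomorphism of $\mathfrak{S}_n\times\mathrm{SL}_2(\mathbb{Q})$-representations \[E_3^{p,0}(n,E)\cong \textstyle\bigwedge^p V(1)\boxtimes \mathbb{V}_p,\] and $\dim_{\mathbb{Q}}E_3^{p,0}(n,E)=\binom{n-1}{p}(p+1)$.
   Context: Let $E$ be a complex elliptic curve, $x,y$ a basis of $H^1(E;\mathbb{Q})$ with $xy$ generating $H^2$. Let $E_2(n)$ be the bigraded algebra over $\mathbb{Q}$ (second page of the rational Leray spectral sequence of the inclusion into $E^n$ of the configuration space of $n$ distinct ordered points of $E$) obtained as the quotient of the free graded-commutative algebra (for total degree) on $x_i,y_i$ ($1\le i\le n$) of bidegree $(1,0)$ and $\omega_{ij}=\omega_{ji}$ ($i\ne j$) of bidegree $(0,1)$ by the relations $(x_i-x_j)\omega_{ij}=0$, $(y_i-y_j)\omega_{ij}=0$, $\omega_{ij}\omega_{jk}+\omega_{jk}\omega_{ki}+\omega_{ki}\omega_{ij}=0$ (distinct $i,j,k$), with differential $d_2$ of bidegree $(2,-1)$, a derivation for total degree, $d_2x_i=d_2y_i=0$, $d_2\omega_{ij}=(x_i-x_j)(y_i-y_j)$. Let $E_2(n,E)$ be the sub-differential bigraded algebra generated by the $x_i-x_j$, $y_i-y_j$, $\omega_{ij}$ (the $E_2$ page for the quotient of the configuration space by diagonal translation by $E$), and $E_3^{p,q}(n,E)$ the cohomology of $(E_2(n,E),d_2)$ in bidegree $(p,q)$. The symmetric group $\mathfrak{S}_n$ acts by permuting indices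 ($\sigma x_i=x_{\sigma(i)}$, $\sigma y_i=y_{\sigma(i)}$, $\sigma\omega_{ij}=\omega_{\sigma(i)\sigma(j)}$); $\mathrm{SL}_2(\mathbb{Q})$ acts via its standard representation on each pair $(x_i,y_i)$ as on $(x,y)$ and trivially on the $\omega_{ij}$. These actions commute with $d_2$. $V(1)$ denotes the standard $(n-1)$-dimensional irreducible representation of $\mathfrak{S}_n$ and $\mathbb{V}_p$ the irreducible $(p+1)$-dimensional representation of $\mathrm{SL}_2(\mathbb{Q})$. *)

(* Defs.v *)
From HB Require Import structures.
From mathcomp Require Import all_boot all_order all_algebra all_fingroup.
From mathcomp Require Import mpoly.
Set Implicit Arguments. Unset Strict Implicit. Unset Printing Implicit Defensive.
Import GRing.Theory.
Local Open Scope ring_scope.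

(* The free graded-commutative Q-algebra on a finite set G of generators,   *)
(* ALL of total degree 1, i.e. the exterior algebra Lambda_Q(G).            *)
(* An element is a function {set G} -> Q (coefficients on the monomials    *)
(* e_A = a_1 a_2 ... a_k, A = {a_1 < ... < a_k}, order = enum order of G).  *)
Section Exterior.
Variable G : finType.

Definition ext := {ffun {set G} -> rat^o}.

Definition eb (A : {set G}) : ext := [ffun B => (B == A)%:R].

(* sign of e_A * e_B = sgnAB e_(A :|: B) when A, B disjoint: number of     *)
(* pairs (a, b) in A x B with b before a                                    *)
Definition sgnAB (A B : {set G}) : rat^o :=
  (-1) ^+ #|[set ab in setX A B | (enum_rank ab.2 < enum_rank ab.1)%N]|.

Definition emul (f g : ext) : ext :=
  [ffun C => \sum_(A : {set G}) \sum_(B : {set G})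
     if (A :&: B == set0) && (A :|: B == C) then sgnAB A B * f A * g B else 0].

Definition eone : ext := eb set0.

Definition eprod (s : seq ext) : ext := foldr emul eone s.

Definition egen (a : G) : ext := eb [set a].

Definition linext (c : {set G} -> ext) (v : ext) : ext :=
  \sum_(A : {set G}) v A *: c A.

Lemma linext_is_linear c : linear (linext c).
Proof.
move=> a u v; rewrite /linext scaler_sumr -big_split /=.
by apply: eq_bigr => A _; rewrite !ffunE scalerDl scalerA.
Qed.

HB.instance Definition _ c :=
  GRing.isLinear.Build rat ext ext *:%R (linext c) (@linext_is_linear c).

Definition algmap (f : G -> ext) : ext -> ext :=
  linext (fun A => eprod [seq f a | a <- enum A]).

(* the derivation (for the total degree) with d a = dg a on generators:    *)
(* d (a * m) = d(a) * m - a * d(m)  (a of odd total degree 1)              *)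
Fixpoint dword (dg : G -> ext) (s : seq G) : ext :=
  match s with
  | [::] => 0
  | a :: s' => emul (dg a) (eprod (map egen s')) - emul (egen a) (dword dg s')
  end.
Definition ederiv (dg : G -> ext) : ext -> ext :=
  linext (fun A => dword dg (enum A)).

(* span of all products of words (of length <= #|G|; longer products      *)
(* vanish) in a list of elements: the subalgebra generated by the list     *)
Definition subalg (gens : seq ext) : {vspace ext} :=
  <<flatten [seq [seq eprod [seq gens`_(val i) | i <- t]
                    | t : k.-tuple 'I_(size gens) <- enum [set: k.-tuple 'I_(size gens)]]
              | k <- iota 0 #|G|.+1]>>%VS.

Definition ideal (rels : seq ext) : {vspace ext} :=
  <<flatten (flatten [seq [seq [seq emul (emul (eb A) r) (eb B) | B <- enum [set: {set G}]]
                    | r <- rels]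
              | A <- enum [set: {set G}]]) >>%VS.

End Exterior.

Arguments eb {G}. Arguments eone {G}. Arguments egen {G}.

(* Generators: x_i (inl (inl i)), y_i (inl (inr i)), and one generator      *)
(* omega_{ij} = omega_{ji} for each unordered pair, indexed by (i,j), i<j.  *)
(* All generators have total degree 1 (bidegrees (1,0) resp. (0,1)).      *)
Section E2.
Variable n : nat.

Definition omgidx := {pr : 'I_n * 'I_n | (pr.1 < pr.2)%N}.
Definition gen := (('I_n + 'I_n) + omgidx)%type.
Definition E := ext gen.

Definition xg (i : 'I_n) : E := egen (inl (inl i)).
Definition yg (i : 'I_n) : E := egen (inl (inr i)).
(* omega_{ij} for i <> j (symmetric in i, j); unused (= 0) for i = j *)
Definition om (i j : 'I_n) : E :=
  match (insub (i, j) : option omgidx) with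
  | Some w => egen (inr w)
  | None => match (insub (j, i) : option omgidx) with
            | Some w => egen (inr w)
            | None => 0
            end
  end.

Definition isxy (a : gen) : bool := if a is inl _ then true else false.
Definition bideg (A : {set gen}) : nat * nat :=
  (#|[set a in A | isxy a]|, #|[set a in A | ~~ isxy a]|).
Definition Vbideg (p q : nat) : {vspace E} :=
  <<[seq eb A | A <- enum [set: {set gen}] & bideg A == (p, q)]>>%VS.

Definition pairs : seq ('I_n * 'I_n) :=
  [seq ij <- [seq (i, j) | i <- enum 'I_n, j <- enum 'I_n] | ij.1 != ij.2].
Definition triples : seq ('I_n * 'I_n * 'I_n) :=
  [seq t <- [seq (ij.1, ij.2, k) | ij <- [seq (i, j) | i <- enum 'I_n, j <- enum 'I_n],
                                   k <- enum 'I_n]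
   | [&& t.1.1 != t.1.2, t.1.2 != t.2 & t.2 != t.1.1]].

Definition rels : seq E :=
  flatten [seq [:: emul (xg ij.1 - xg ij.2) (om ij.1 ij.2);
                   emul (yg ij.1 - yg ij.2) (om ij.1 ij.2)] | ij <- pairs]
  ++ [seq let: (i, j, k) := t in
          emul (om i j) (om j k) + emul (om j k) (om k i) + emul (om k i) (om i j)
     | t <- triples].

Definition Iid : {vspace E} := ideal rels.

Definition gensE : seq E :=
  [seq xg ij.1 - xg ij.2 | ij <- pairs] ++ [seq yg ij.1 - yg ij.2 | ij <- pairs]
  ++ [seq om ij.1 ij.2 | ij <- pairs].

Definition d2gen (a : gen) : E :=
  match a with
  | inl _ => 0
  | inr w => emul (xg (val w).1 - xg (val w).2) (yg (val w).1 - yg (val w).2)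
  end.
Definition d2 : E -> E := ederiv d2gen.
HB.instance Definition _ := GRing.Linear.copy d2 (linext _).
Definition d2f : 'End(E) := linfun d2.

(* lift to the free algebra of the bidegree (p,q) part of E_2(n,E):        *)
(* E_2^{p,q}(n,E) = E2lift p q / Ipq p q                                    *)
Definition E2lift (p q : nat) : {vspace E} :=
  ((subalg gensE + Iid) :&: Vbideg p q)%VS.
Definition Ipq (p q : nat) : {vspace E} := (Iid :&: Vbideg p q)%VS.

(* lifts of cocycles and coboundaries in bidegree (p,q):                   *)
(* E_3^{p,q}(n,E) = E3cyc p q / E3bd p q                                    *)
Definition E3cyc (p q : nat) : {vspace E} :=
  (E2lift p q :&: (d2f @^-1: Iid))%VS.
Definition E3bd (p q : nat) : {vspace E} :=
  ((if (2 <= p)%N then d2f @: E2lift (p - 2) q.+1 else 0) + Ipq p q)%VS.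

Definition perm_gen (s : 'S_n) (a : gen) : E :=
  match a with
  | inl (inl i) => xg (s i)
  | inl (inr i) => yg (s i)
  | inr w => om (s (val w).1) (s (val w).2)
  end.
Definition sl2_gen (g : 'M[rat]_2) (a : gen) : E :=
  match a with
  | inl (inl i) => g 0 0 *: xg i + g 1 0 *: yg i
  | inl (inr i) => g 0 1 *: xg i + g 1 1 *: yg i
  | inr w => egen (inr w)
  end.
Definition actE (s : 'S_n) (g : 'M[rat]_2) (v : E) : E :=
  algmap (perm_gen s) (algmap (sl2_gen g) v).

(* /\(Q^n) = ext 'I_n ; V(1) = span of e_i - e_j (sum-zero vectors);        *)
(* V_p = homogeneous polynomials of degree p in Q[X0,X1], SL_2 acting by    *)
(* linear substitution (X0 |-> g00 X0 + g10 X1, X1 |-> g01 X0 + g11 X1).    *)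
(* (/\(Q^n)) (x) Q[X0,X1] is modelled as {ffun {set 'I_n} -> Q[X0,X1]}.     *)
Definition Tgt := {ffun {set 'I_n} -> {mpoly rat[2]}}.

Definition tens (w : ext 'I_n) (P : {mpoly rat[2]}) : Tgt :=
  [ffun A => (w A : rat) *: P].

Definition V1gens : seq (ext 'I_n) :=
  [seq egen i - egen j | i <- enum 'I_n, j <- enum 'I_n].
Definition LamV1 (p : nat) : {vspace ext 'I_n} :=
  <<[seq eprod [seq V1gens`_(val i) | i <- t]
     | t : p.-tuple 'I_(size V1gens) <- enum [set: p.-tuple 'I_(size V1gens)]]>>%VS.

Definition inTgt (p : nat) (F : Tgt) : Prop :=
  exists s : seq (ext 'I_n * {mpoly rat[2]}),
    [/\ all (fun x => x.1 \in LamV1 p) s,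
        all (fun x => x.2 \is p.-homog) s
      & F = \sum_(x <- s) tens x.1 x.2].

Definition sl2_poly (g : 'M[rat]_2) (P : {mpoly rat[2]}) : {mpoly rat[2]} :=
  P \mPo [tuple g 0 0 *: 'X_ord0 + g 1 0 *: 'X_ord_max;
                g 0 1 *: 'X_ord0 + g 1 1 *: 'X_ord_max].

Definition actT (s : 'S_n) (g : 'M[rat]_2) (F : Tgt) : Tgt :=
  [ffun C => \sum_(A : {set 'I_n})
               ((algmap (fun i => egen (s i)) (eb A)) C : rat) *: sl2_poly g (F A)].

End E2.

(* Main.v *)
(* Put V = V(1) and W = <x, y>.  In bidegree (p, 0) everything is a cocycle,
   and E_3^{p,0} is the degree-p part of the exterior algebra of V (x) W modulo
   the ideal generated by the d_2(omega_ij) = (x_i - x_j)(y_i - y_j).  The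
   algebra morphism phi with x_i |-> e_i X0, y_i |-> e_i X1, omega_ij |-> 0 kills
   every d_2-boundary because (e_i - e_j)^2 = 0.  Conversely, polarization shows
   that (v x)(w y) = - (w x)(v y) modulo the ideal, so that the "colours" x and y
   of the factors of a product may be exchanged: a product
   (v_1 c_1) ... (v_p c_p) only depends on the v_i and on the number k of y's, and
   is 1 / 'C(p, k) times the sum F_k(v_1 /\ ... /\ v_p) of all colourings with k
   letters y.  As phi(F_k u) = 'C(p, k) u X0^(p-k) X1^k, phi is an isomorphism from
   E_3^{p,0} onto /\^p V (x) Sym^p W, and the F_k split the cocycles, whence the
   dimension. *)

(* The first obstacle is that E_2(n,E) is only given through lifts, a subalgebra plus the ideal of
   relations, in a free algebra containing the omegas. The morphism [rho] that kills the omegas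
   removes the ideal: every relation contains an omega, and the part of its d_2 free of omegas is a
   multiple of (x_i - x_j) q or (y_i - y_j) q with q = (x_i - x_j)(y_i - y_j), already 0 in the
   exterior algebra. So E_2^{p,0} is a genuine subspace of the free algebra, the p-th power of V (x)
   W, and d_2 into it can be computed on words in the generators.

   The coboundaries are never computed directly. They are caught between [swapI], the ideal
   generated by the d_2(omega_ij), and the kernel of [phi] on the cocycles. As the cocycles are the
   sum of [swapI] and the colour sums, on which [phi] is injective, the three spaces coincide.

   Signs are handled by words: a linear map on an exterior algebra is given by an alternating
   function of words, so no formula has to be checked on sorted monomials. Characteristic 0 enters
   through divisions by 2, by p + 1 and by 'C(p, k). *)
Require Import Defs.
From HB Require Import structures.
From mathcomp Require Import all_boot all_order all_algebra all_fingroup.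
From mathcomp Require Import falgebra mpoly ring.
Set Implicit Arguments. Unset Strict Implicit. Unset Printing Implicit Defensive.
Import GRing.Theory.
Local Open Scope ring_scope.

(** * Exterior algebras *)

(* K = rat^o gives [ext G], with [emul] convertible to the product below, and
   K = {mpoly rat[2]} gives [Tgt n]; the alias hides the pointwise product that
   {ffun _ -> _} already carries. *)
Definition xalg (K : comAlgType rat) (G : finType) := {ffun {set G} -> K}.

Section XalgRing.
Variables (K : comAlgType rat) (G : finType).
Notation xalg := (xalg K G).
Implicit Types (A B C D S : {set G}) (f g h : xalg).

HB.instance Definition _ := GRing.Lmodule.copy xalg {ffun {set G} -> K}.

Definition ninv A B : nat :=
  #|[set ab in setX A B | (enum_rank ab.2 < enum_rank ab.1)%N]|.

Lemma ninvUl A B C : A :&: B == set0 ->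
  ninv (A :|: B) C = (ninv A C + ninv B C)%N.
Proof.
move=> /eqP AB0; rewrite /ninv -cardsUI.
set I := (X in (_ + #|pred_of_set X|)%N); have -> : I = set0.
  apply/setP=> -[a b]; have := in_set0 a; rewrite -AB0 !inE /=.
  by case: (a \in A); case: (a \in B); rewrite //= ?andbF.
rewrite cards0 addn0; apply: eq_card => -[a b]; rewrite !inE /=.
by case: (a \in A); case: (a \in B); case: (b \in C); rewrite ?orbF ?andbF ?orbb.
Qed.

Lemma ninvUr A B C : B :&: C == set0 ->
  ninv A (B :|: C) = (ninv A B + ninv A C)%N.
Proof.
move=> /eqP BC0; rewrite /ninv -cardsUI.
set I := (X in (_ + #|pred_of_set X|)%N); have -> : I = set0.
  apply/setP=> -[a b]; have := in_set0 b; rewrite -BC0 !inE /=.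
  by case: (b \in B); case: (b \in C); rewrite //= ?andbF.
rewrite cards0 addn0; apply: eq_card => -[a b]; rewrite !inE /=.
by case: (a \in A); case: (b \in B); case: (b \in C); rewrite ?orbF ?andbF ?orbb.
Qed.

Lemma ninv0s A : ninv set0 A = 0%N.
Proof. by apply: eq_card0 => -[a b]; rewrite !inE. Qed.

Lemma ninvs0 A : ninv A set0 = 0%N.
Proof. by apply: eq_card0 => -[a b]; rewrite !inE andbF. Qed.

Definition xmul f g : xalg :=
  [ffun C => \sum_A \sum_B
     if (A :&: B == set0) && (A :|: B == C) then (-1) ^+ ninv A B * f A * g B else 0].

Definition xb A : xalg := [ffun B => (B == A)%:R].
Definition xone : xalg := xb set0.

(** Structure constants of the product in the basis [xb]: with the condition turned into a factor,
    associativity becomes the identity [cfA] between scalars. *)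
Let cf A B C : K :=
  if (A :&: B == set0) && (A :|: B == C) then (-1) ^+ ninv A B else 0.

Let xmulE f g C : xmul f g C = \sum_A \sum_B cf A B C * f A * g B.
Proof.
rewrite ffunE; apply: eq_bigr => A _; apply: eq_bigr => B _; rewrite /cf.
by case: ifP => // _; rewrite !mul0r.
Qed.

(** Each sum has a single possibly non-zero term, S = A :|: B on the left and S = B :|: D on the
    right. Both survive exactly when A, B, D are pairwise disjoint with union C, and then additivity
    of [ninv] equates the signs. *)
Let cfA A B D C :
  \sum_S cf A B S * cf S D C = \sum_S cf B D S * cf A S C.
Proof.
rewrite (bigD1 (A :|: B)) //= big1 ?addr0; last first.
  by move=> S nS; rewrite /cf [_ == S]eq_sym (negbTE nS) andbF mul0r.
rewrite [RHS](bigD1 (B :|: D)) //= big1 ?addr0; last first.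
  by move=> S nS; rewrite /cf [_ == S]eq_sym (negbTE nS) andbF mul0r.
rewrite /cf !eqxx !andbT setIUl setIUr !setU_eq0 setUA.
case AB: (A :&: B == set0); case BD: (B :&: D == set0); rewrite ?andbF ?mulr0 ?mul0r //=.
rewrite andbT; case: ifP => [|_]; rewrite ?mulr0 // => /andP[_ _].
by rewrite -!exprD ninvUl // ninvUr // addnA addnC addnA addnAC [(ninv B D + _)%N]addnC.
Qed.

Fact xmulA : associative xmul.
Proof.
move=> f g h; apply/ffunP=> C; rewrite !xmulE.
transitivity (\sum_A \sum_B \sum_D (\sum_S cf B D S * cf A S C) * (f A * g B * h D)).
  apply: eq_bigr => A _.
  under eq_bigr => S _ do rewrite xmulE mulr_sumr.
  rewrite exchange_big; apply: eq_bigr => B _.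
  under eq_bigr => S _ do rewrite mulr_sumr.
  rewrite exchange_big; apply: eq_bigr => D _.
  rewrite mulr_suml; apply: eq_bigr => S _.
  by ring.
symmetry.
transitivity (\sum_S \sum_D \sum_A \sum_B (cf A B S * cf S D C) * (f A * g B * h D)).
  apply: eq_bigr => S _; apply: eq_bigr => D _.
  rewrite xmulE mulr_sumr mulr_suml; apply: eq_bigr => A _.
  rewrite mulr_sumr mulr_suml; apply: eq_bigr => B _.
  by ring.
under eq_bigr => S _ do rewrite exchange_big /=.
rewrite exchange_big; apply: eq_bigr => A _.
under eq_bigr => S _ do rewrite exchange_big /=.
rewrite exchange_big; apply: eq_bigr => B _.
rewrite exchange_big; apply: eq_bigr => D _.
by rewrite -mulr_suml cfA.
Qed.

Fact xmul1l : left_id xone xmul.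
Proof.
move=> f; apply/ffunP=> C; rewrite xmulE (bigD1 set0) //= [X in _ + X]big1 ?addr0; last first.
  by move=> A nA; rewrite big1 // => B _; rewrite ffunE (negbTE nA) mulr0 mul0r.
rewrite (bigD1 C) //= big1 ?addr0; last first.
  by move=> B nB; rewrite /cf set0U (negbTE nB) andbF !mul0r.
by rewrite /cf set0I set0U !eqxx ninv0s ffunE eqxx !mul1r.
Qed.

Fact xmul1r : right_id xone xmul.
Proof.
move=> f; apply/ffunP=> C; rewrite xmulE exchange_big (bigD1 set0) //=.
rewrite [X in _ + X]big1 ?addr0; last first.
  by move=> A nA; rewrite big1 // => B _; rewrite ffunE (negbTE nA) mulr0.
rewrite (bigD1 C) //= big1 ?addr0; last first.
  by move=> B nB; rewrite /cf setU0 (negbTE nB) andbF !mul0r.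
by rewrite /cf setI0 setU0 !eqxx ninvs0 ffunE eqxx !mul1r mulr1.
Qed.

Fact xmulDl : left_distributive xmul +%R.
Proof.
move=> f g h; apply/ffunP=> C; rewrite !(xmulE, ffunE) -big_split.
apply: eq_bigr => A _; rewrite -big_split; apply: eq_bigr => B _.
by rewrite /= ffunE mulrDr mulrDl.
Qed.

Fact xmulDr : right_distributive xmul +%R.
Proof.
move=> f g h; apply/ffunP=> C; rewrite !(xmulE, ffunE) -big_split.
apply: eq_bigr => A _; rewrite -big_split; apply: eq_bigr => B _.
by rewrite /= ffunE mulrDr.
Qed.

Fact xone_neq0 : xone != 0.
Proof.
by apply/eqP => /ffunP/(_ set0)/eqP; rewrite !ffunE eqxx oner_eq0.
Qed.

HB.instance Definition _ :=
  GRing.Zmodule_isNzRing.Build xalg xmulA xmul1l xmul1r xmulDl xmulDr xone_neq0.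

Fact xscaleAl (a : rat) f g : a *: (f * g) = a *: f * g.
Proof.
apply/ffunP=> C; rewrite ffunE !xmulE scaler_sumr; apply: eq_bigr => A _.
by rewrite scaler_sumr; apply: eq_bigr => B _; rewrite !ffunE -!scalerAr -scalerAl.
Qed.

Fact xscaleAr (a : rat) f g : a *: (f * g) = f * (a *: g).
Proof.
apply/ffunP=> C; rewrite ffunE !xmulE scaler_sumr; apply: eq_bigr => A _.
by rewrite scaler_sumr; apply: eq_bigr => B _; rewrite !ffunE -!scalerAr.
Qed.

HB.instance Definition _ := GRing.Lmodule_isLalgebra.Build rat xalg xscaleAl.
HB.instance Definition _ := GRing.Lalgebra_isAlgebra.Build rat xalg xscaleAr.

Lemma xb_mul A B :
  xb A * xb B = if A :&: B == set0 then (-1) ^+ ninv A B *: xb (A :|: B) else 0.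
Proof.
apply/ffunP=> C; rewrite xmulE (bigD1 A) //= [X in _ + X]big1 ?addr0; last first.
  by move=> S nS; rewrite big1 // => T _; rewrite ffunE (negbTE nS) mulr0 mul0r.
rewrite (bigD1 B) //= big1 ?addr0; last first.
  by move=> S nS; rewrite [xb B S]ffunE (negbTE nS) mulr0.
rewrite !ffunE !eqxx !mulr1 /cf; case: (A :&: B == set0); last by rewrite ffunE.
rewrite ffunE ffunE [C == _]eq_sym /=; case: (_ == C); last by rewrite scaler0.
by rewrite -signr_odd -[in RHS]signr_odd; case: (odd _); rewrite ?scaleN1r ?scale1r.
Qed.

End XalgRing.


Notation ealg := (xalg rat^o).

(** The finite-dimensional algebra structure provides products and powers of subspaces, in terms of
    which the cocycles ([E3cycE]) and the exterior powers of V(1) ([LamV1E]) are expressed. *)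
HB.instance Definition _ G := Vector.copy (ealg G) (ext G).
HB.instance Definition _ G := Algebra_isFalgebra.Build rat (ealg G).

Lemma emulE G (u v : ext G) : emul u v = (u : ealg G) * v.
Proof. by []. Qed.

Lemma eprodE (I : Type) G (f : I -> ext G) s :
  eprod [seq f a | a <- s] = \prod_(a <- s) (f a : ealg G).
Proof. by elim: s => [|a s IH]; rewrite ?big_nil // big_cons -IH. Qed.

(** * Alternating functions of words *)

Section Alternating.
Variable G : finType.

Definition alternating (V : lmodType rat) (F : seq G -> V) :=
  forall s1 a b s2, F (s1 ++ a :: b :: s2) = - F (s1 ++ b :: a :: s2).

Lemma eq_opp0 (V : lmodType rat) (v : V) : v = - v -> v = 0.
Proof.
move=> vN; have /eqP : (2%:R : rat) *: v = 0.
  by rewrite scaler_nat mulr2n [X in X + _]vN addNr.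
by rewrite scaler_eq0 => /orP[//|/eqP].
Qed.

Lemma alt_cons (V : lmodType rat) (F : seq G -> V) a :
  alternating F -> alternating (fun s => F (a :: s)).
Proof. by move=> altF s1 b c s2; rewrite -!cat_cons altF. Qed.

Lemma alt_move (V : lmodType rat) (F : seq G -> V) a s1 s2 : alternating F ->
  F (a :: s1 ++ s2) = (-1) ^+ size s1 *: F (s1 ++ a :: s2).
Proof.
elim: s1 F => [|b s1 IH] F altF /=; first by rewrite expr0 scale1r.
rewrite (altF [::]) /= (IH (fun s => F (b :: s))) ?exprS ?mulN1r ?scaleNr //.
exact: alt_cons.
Qed.

(** The scalar is chosen before [V] and [F], so that [lext_word] can compare two alternating
    functions with values in different spaces. *)
Lemma alt_perm s t : perm_eq s t ->
  exists e : rat, forall (V : lmodType rat) (F : seq G -> V), alternating F -> F s = e *: F t.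
Proof.
elim: s t => [|a s IH] t pst.
  exists 1 => V F _; rewrite scale1r; congr F.
  by apply/esym/perm_nilP; rewrite perm_sym.
have at_ : a \in t by rewrite -(perm_mem pst) mem_head.
case/splitPr: at_ pst => t1 t2.
rewrite perm_sym -cat1s perm_catCA perm_cons perm_sym => /IH[e Fe].
exists (e * (-1) ^+ size t1) => V F altF.
by rewrite (Fe _ _ (alt_cons a altF)) -scalerA -alt_move.
Qed.

Lemma alt_dup (V : lmodType rat) (F : seq G -> V) s :
  alternating F -> ~~ uniq s -> F s = 0.
Proof.
elim: s F => [|a s IH] //= F altF; rewrite negb_and negbK => /orP[as_|us].
  have [s1 [s2 ->]] : exists s1 s2, s = s1 ++ a :: s2.
    by case/splitPr: as_ => s1 s2; exists s1, s2.
  apply: (scalerI (negbT (signr_eq0 rat (size s1)))); rewrite scaler0.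
  have /= <- := alt_move a s1 s2 (alt_cons a altF).
  exact: eq_opp0 (altF [::] a a _).
by rewrite (IH (fun s => F (a :: s))) //; exact: alt_cons.
Qed.

(* [algmap] and [ederiv] are of this form, and so is every algebra morphism or
   derivation below: [lext_word] reduces their properties to words. *)
Definition lext (V : lmodType rat) (F : seq G -> V) (v : ext G) : V :=
  \sum_(A : {set G}) (v A : rat) *: F (enum A).

Fact lext_is_linear (V : lmodType rat) (F : seq G -> V) : linear (lext F).
Proof.
move=> a u v; rewrite /lext scaler_sumr -big_split /=.
by apply: eq_bigr => A _; rewrite !ffunE scalerDl scalerA.
Qed.

HB.instance Definition _ (V : lmodType rat) (F : seq G -> V) :=
  GRing.isLinear.Build rat (ext G) V *:%R (lext F) (lext_is_linear F).

Lemma lext_eb (V : lmodType rat) (F : seq G -> V) A : lext F (eb A) = F (enum A).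
Proof.
rewrite /lext (bigD1 A) //= big1 ?addr0 => [|B nB]; rewrite ffunE.
  by rewrite eqxx scale1r.
by rewrite (negbTE nB) scale0r.
Qed.

Lemma ext_sum_eb (v : ext G) : v = \sum_A v A *: eb A.
Proof.
apply/ffunP=> B; rewrite sum_ffunE (bigD1 B) //= big1 ?addr0 => [|A nA].
  by rewrite !ffunE eqxx [_ *: _]mulr1.
by rewrite !ffunE eq_sym (negbTE nA) [_ *: _]mulr0.
Qed.

Definition anticomm (A : pzRingType) (f : G -> A) :=
  forall a b, f a * f b = - (f b * f a).

Definition wprod (A : algType rat) (f : G -> A) s : A := \prod_(a <- s) f a.

Lemma alt_wprod (A : algType rat) (f : G -> A) : anticomm f -> alternating (wprod f).
Proof.
move=> acf s1 a b s2; rewrite /wprod !big_cat /= !big_cons !mulrA.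
by rewrite -(mulrA _ (f a)) acf mulrN !mulNr !mulrA.
Qed.

Definition eg (a : G) : ealg G := egen a.

Lemma eg_mul a b : eg a * eg b =
  if a == b then 0
  else (-1) ^+ (enum_rank b < enum_rank a)%N *: (eb [set a; b] : ealg G).
Proof.
rewrite /eg [LHS]xb_mul.
have -> : ([set a] :&: [set b] == set0) = (a != b).
  rewrite setI_eq0 disjoints1 inE //.
case: (eqVneq a b) => //= nab; congr (_ *: _); congr (_ ^+ _).
rewrite /ninv; case: (boolP (enum_rank b < enum_rank a)%N) => lt_ba /=.
  rewrite -(cards1 (a, b)); apply: eq_card => -[c d]; rewrite !inE /= xpair_eqE.
  by case: eqP => // ->; case: eqP => // ->; rewrite lt_ba.
apply: eq_card0 => -[c d]; rewrite !inE /=.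
by case: eqP => // ->; case: eqP => // ->; rewrite (negbTE lt_ba).
Qed.

Lemma eg_anticomm : anticomm eg.
Proof.
move=> a b; rewrite !eg_mul [b == a]eq_sym [[set b; a]]setUC.
case: (eqVneq a b) => [|nab]; first by rewrite oppr0.
have: enum_rank a != enum_rank b by rewrite (inj_eq enum_rank_inj).
rewrite -(inj_eq val_inj) /=; case: ltngtP => //= _ _;
  by rewrite ?scaleN1r ?scale1r ?opprK.
Qed.

(** An increasing enumeration has no inversions, so every sign coming from [xb_mul] is trivial. The
    set is first rewritten as the set of letters of its enumeration, which allows induction on the
    list. *)
Lemma eb_wprod (A : {set G}) : wprod eg (enum A) = eb A.
Proof.
have enumP : pairwise (fun a b => enum_rank a < enum_rank b)%N (enum A).
  have -> : enum A = [seq x <- enum G | x \in A].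
    by rewrite {2}/enum_mem filter_predT.
  apply: pairwise_filter; case: (pickP G) => [x0 _|G0]; last first.
    by rewrite (eq_enum (B := pred0)) ?enum0 // => x; have := G0 x.
  apply/(pairwiseP x0) => i j; rewrite !inE -!cardT => ltiG ltjG ltij.
  rewrite -[i]/(val (Ordinal ltiG)) -[j]/(val (Ordinal ltjG)).
  by rewrite -!enum_val_nth !enum_valK.
have -> : eb A = eb [set x in enum A] :> ealg G.
  by congr eb; apply/setP=> x; rewrite inE mem_enum.
elim: (enum A) enumP => [_|a s IH /= /andP[/allP lt_as /IH]].
  by rewrite /wprod big_nil; congr xb; apply/setP=> x; rewrite !inE.
rewrite /wprod big_cons => ->; rewrite [LHS]xb_mul.
have nas : a \notin s by apply/negP => /lt_as; rewrite ltnn.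
rewrite setI_eq0 disjoints1 inE nas.
have -> : ninv [set a] [set x in s] = 0%N.
  apply: eq_card0 => -[c d]; rewrite !inE /=; apply/negP.
  by case/andP=> /andP[/eqP-> /lt_as lt_ad]; rewrite ltnNge ltnW.
rewrite scale1r; congr xb; apply/setP=> x; rewrite !inE //.
Qed.

(** Both [F] and [wprod eg] vanish on a word with a repeated letter, and otherwise change by the
    same scalar when the word is sorted; on sorted words the claim is [lext_eb]. *)
Lemma lext_word (V : lmodType rat) (F : seq G -> V) s :
  alternating F -> lext F (wprod eg s) = F s.
Proof.
move=> altF; have altP := alt_wprod eg_anticomm.
have [us|nus] := boolP (uniq s); last first.
  by rewrite !(alt_dup _ nus) // linear0.
have [|e Fe] := @alt_perm s (enum [set x in s]).
  by apply: uniq_perm; rewrite ?enum_uniq // => x; rewrite mem_enum inE.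
rewrite (Fe _ _ altF) (Fe _ _ altP) linearZ eb_wprod /=.
by congr (_ *: _); exact: lext_eb.
Qed.

Section LextMorphism.
Variables (A : algType rat) (f : G -> A).
Hypothesis acf : anticomm f.
Let phi : ealg G -> A := lext (wprod f).

(** The product of two basis vectors is the word obtained by concatenation; [lext_word] evaluates it
    although it may be unsorted or have repetitions. *)
Lemma lext_mul (u v : ealg G) : phi (u * v) = phi u * phi v.
Proof.
rewrite [u]ext_sum_eb [v]ext_sum_eb /phi.
rewrite !linear_sum mulr_suml [LHS](@linear_sum _ (ealg G)) mulr_suml; apply: eq_bigr => B _.
rewrite mulr_sumr linear_sum mulr_sumr; apply: eq_bigr => C _.
rewrite -scalerAl -scalerAr !linearZ /= -scalerAl -scalerAr.
by rewrite -!eb_wprod /wprod -big_cat !lext_word ?big_cat //; exact: alt_wprod.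
Qed.

Lemma lext_eg a : phi (eg a) = f a.
Proof.
by rewrite -[eg a](big_seq1 *%R a eg) [LHS]lext_word ?/wprod ?big_seq1 //; exact: alt_wprod.
Qed.

Lemma lext_one : phi 1 = 1.
Proof.
have -> : (1 : ealg G) = wprod eg [::] by rewrite /wprod big_nil.
by rewrite [LHS]lext_word /wprod ?big_nil //; exact: alt_wprod.
Qed.

End LextMorphism.

End Alternating.

Arguments eg {G}. Arguments eg_anticomm {G}.

Section SpanInduction.
Variable K : fieldType.

Lemma span_ind (vT : vectType K) (P : vT -> Prop) (X : seq vT) :
    P 0 -> (forall a u v, P u -> P v -> P (a *: u + v)) ->
    (forall x, x \in X -> P x) ->
  forall v, v \in <<X>>%VS -> P v.
Proof.
move=> P0 Plin PX v /(@coord_span _ _ _ (in_tuple X)) ->.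
elim/big_ind: _ => [||i _] //.
  by move=> u w Pu Pw; rewrite -[u]scale1r; apply: Plin.
by rewrite -[_ *: _]addr0; apply: Plin => //; apply/PX/mem_nth.
Qed.

Lemma memv_lin (vT : vectType K) (U : {vspace vT}) a u v :
  u \in U -> v \in U -> a *: u + v \in U.
Proof. by move=> uU vU; apply: memvD => //; apply: memvZ. Qed.

Variable aT : falgType K.

Lemma prodv_ind (P : aT -> Prop) (U V : {vspace aT}) :
    P 0 -> (forall a u v, P u -> P v -> P (a *: u + v)) ->
    (forall u v, u \in U -> v \in V -> P (u * v)) ->
  forall w, w \in (U * V)%VS -> P w.
Proof.
move=> P0 Plin PUV; rewrite unlock; apply: span_ind => // w /allpairsP[[u v] /= [uU vV ->]].
by apply: PUV; apply: vbasis_mem.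
Qed.

End SpanInduction.

(** * Elements of degree 1 and powers of their subspaces *)

Section Degree1.
Variable G : finType.
Implicit Types (u v : ealg G) (gens : seq (ealg G)).

Definition deg1 : {vspace ealg G} := <<[seq eg a | a <- enum G]>>%VS.

Lemma eg_deg1 a : eg a \in deg1.
Proof. by apply/memv_span/map_f; rewrite mem_enum. Qed.

Lemma deg1_anticomm u v : u \in deg1 -> v \in deg1 -> u * v = - (v * u).
Proof.
move=> u1; elim/span_ind: v / => [|a v w vE wE|_ /mapP[b _ ->]].
- by rewrite mulr0 mul0r oppr0.
- by rewrite mulrDr mulrDl -scalerAr -scalerAl vE wE scalerN opprD.
elim/span_ind: u / u1 => [|a u w uE wE|_ /mapP[c _ ->]].
- by rewrite mulr0 mul0r oppr0.
- by rewrite mulrDr mulrDl -scalerAr -scalerAl uE wE scalerN opprD.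
exact: eg_anticomm.
Qed.

Lemma deg1_sqr u : u \in deg1 -> u * u = 0.
Proof. by move=> u1; apply: (@eq_opp0 (ealg G)); apply: deg1_anticomm. Qed.

Lemma deg1_central u v w : u \in deg1 -> v \in deg1 -> u * v * w = w * (u * v).
Proof.
move=> u1 v1; rewrite [w]ext_sum_eb mulr_suml mulr_sumr; apply: eq_bigr => A _.
rewrite -scalerAl -scalerAr -eb_wprod; congr (_ *: _); rewrite /wprod.
elim: (enum A) => [|a s IH]; first by rewrite big_nil mulr1 mul1r.
rewrite big_cons -[RHS]mulrA -IH !mulrA; congr (_ * _).
have a1 := eg_deg1 a. rewrite -[LHS]mulrA (deg1_anticomm v1 a1) mulrN.
by rewrite mulrA (deg1_anticomm u1 a1) !mulNr opprK.
Qed.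

(** This is the list of words that occurs both in [subalg] and in [LamV1]; [span_twords] turns each
    of them into powers of a subspace. *)
Definition twords gens k : seq (ealg G) :=
  [seq eprod [seq gens`_(val i) | i <- t]
    | t : k.-tuple 'I_(size gens) <- enum [set: k.-tuple 'I_(size gens)]].

Lemma span_twords gens k : <<twords gens k>>%VS = (<<gens>> ^+ k)%VS.
Proof.
apply/eqP; rewrite eqEsubv; apply/andP; split.
  apply/span_subvP => _ /mapP[t _ ->]; rewrite eprodE.
  elim: k t => [|k IH] t; first by rewrite tuple0 big_nil; exact: memv_line.
  case/tupleP: t => i t; rewrite big_cons expvSl; apply: memv_mul; last exact: IH.
  by apply/memv_span/mem_nth; exact: ltn_ord.
elim: k => [|k IH].
  rewrite expv0 -memvE; apply/memv_span/mapP; exists [tuple] => //.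
  by rewrite mem_enum inE.
rewrite expvSl; apply: subv_trans (prodvSr _ IH) _; apply/prodvP => u v uX vW.
elim/span_ind: u / uX => [|a u w uE wE|u uX].
- by rewrite mul0r mem0v.
- by rewrite mulrDl -scalerAl; apply: (memv_lin _ uE wE).
elim/span_ind: v / vW => [|a w v wE vE|_ /mapP[t _ ->]].
- by rewrite mulr0 mem0v.
- by rewrite mulrDr -scalerAr; apply: (memv_lin _ wE vE).
have lt_u : (index u gens < size gens)%N by rewrite index_mem.
apply/memv_span/mapP; exists [tuple of Ordinal lt_u :: t]; first by rewrite mem_enum inE.
by rewrite /= nth_index.
Qed.

Lemma deg1_expv_gt k : (#|G| < k)%N -> (deg1 ^+ k = 0)%VS.
Proof.
move=> ltGk; apply/eqP; rewrite -subv0 -span_twords; apply/span_subvP => _ /mapP[t _ ->].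
rewrite eprodE.
have [s [<- sk]] : exists s,
    wprod eg s = \prod_(i <- t) [seq eg a | a <- enum G]`_(val i) /\ size s = k.
  (* A default letter for [nth] requires G to be non-empty; for empty G there is no index with which
     to fill a tuple of positive length. *)
  have [x0 _|G0] := pickP G; last first.
    case: k ltGk t => // k _ t; have := ltn_ord (thead t).
    by rewrite [X in (_ < X)%N]size_map -cardE (eq_card0 G0).
  exists [seq nth x0 (enum G) (val i) | i <- t]; split; last by rewrite [LHS]size_map size_tuple.
  rewrite /wprod big_map; apply: eq_bigr => i _.
  apply/esym/nth_map; have := ltn_ord i; by rewrite [X in (_ < X)%N -> _]size_map.
rewrite (alt_dup (alt_wprod eg_anticomm)) ?mem0v //.
by apply/negP => /card_uniqP us; have := max_card (mem s); rewrite us sk leqNgt ltGk.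
Qed.

(** There is no bound on k although [subalg] stops at length #|G|: by the pigeonhole principle,
    longer products of elements of degree 1 vanish. *)
Lemma expv_subalg gens k : (<<gens>> <= deg1)%VS -> (<<gens>> ^+ k <= subalg gens)%VS.
Proof.
move=> gens1; have [le_kG|/deg1_expv_gt k0] := leqP k #|G|; last first.
  by apply: subv_trans (expvS k gens1) _; rewrite k0 sub0v.
rewrite -span_twords; apply: sub_span => u uk; apply/flattenP.
by exists (twords gens k) => //; apply: map_f; rewrite mem_iota.
Qed.

Lemma subalg_ind gens (P : ealg G -> Prop) :
    P 0 -> (forall a u v, P u -> P v -> P (a *: u + v)) ->
    (forall k u, u \in (<<gens>> ^+ k)%VS -> P u) ->
  forall v, v \in subalg gens -> P v.
Proof.
move=> P0 Plin PX; apply: span_ind => // u /flattenP[_ /mapP[k _ ->] uk].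
by apply: (PX k); rewrite -span_twords; apply: memv_span.
Qed.

End Degree1.
Arguments deg1 {G}.

(** * Derivations as alternating functions of words *)

Section AlgmapDerivation.
Variable G : finType.

Lemma algmapE (f : G -> ext G) v : algmap f v = lext (@wprod G (ealg G) f) v.
Proof. by apply: eq_bigr => A _; rewrite eprodE. Qed.

Section Derivation.
Variables (dg : G -> ealg G).
Hypothesis dgC : forall a u, dg a * u = u * dg a.
Let d : ealg G -> ealg G := ederiv dg.

Lemma dword_cons a s :
  dword dg (a :: s) = (dg a * wprod eg s - eg a * dword dg s : ealg G).
Proof. by rewrite /= emulE eprodE. Qed.

(** Exchanging a and b exchanges the terms dg a * b and - a * dg b up to sign, because dg a and dg b
    are central. *)
Lemma alt_dword : @alternating G (ealg G) (dword dg).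
Proof.
elim=> [|c s1 IH] a b s2; last first.
  rewrite !cat_cons !dword_cons IH (alt_wprod eg_anticomm).
  by rewrite !mulrN opprK opprD opprK.
rewrite !cat0s !dword_cons /wprod !big_cons !mulrBr !mulrA.
rewrite -(dgC a (eg b)) -(dgC b (eg a)) (eg_anticomm a b) mulNr opprK.
by rewrite opprB opprD addrA addrAC.
Qed.

Lemma ederivE v : d v = lext (dword dg) v.
Proof. by []. Qed.

Lemma ederiv_eg a : d (eg a) = dg a.
Proof.
rewrite -[eg a](big_seq1 *%R a eg) ederivE -/(wprod _ _) lext_word; last exact: alt_dword.
by rewrite dword_cons /wprod big_nil mulr1 mulr0 subr0.
Qed.

Lemma ederiv_deg1 u v : u \in deg1 -> d (u * v) = d u * v - u * d v.
Proof.
elim/span_ind: u / => [|a u w uE wE|_ /mapP[a _ ->]].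
- by rewrite mul0r !ederivE linear0 !mul0r subr0.
- rewrite mulrDl -scalerAl !ederivE !linearP /= -!ederivE uE wE !mulrDl -!scalerAl scalerBr opprD.
  by rewrite addrACA.
rewrite ederiv_eg [v]ext_sum_eb mulr_sumr !ederivE !linear_sum !mulr_sumr -sumrB.
apply: eq_bigr => A _; rewrite -scalerAr !linearZ -!scalerAr -scalerBr; congr (_ *: _).
rewrite -eb_wprod.
have -> : eg a * wprod eg (enum A) = wprod eg (a :: enum A).
  by rewrite /wprod big_cons.
rewrite [LHS]lext_word; last exact: alt_dword.
rewrite dword_cons; congr (_ - _ * _); symmetry; apply: lext_word; exact: alt_dword.
Qed.

End Derivation.
End AlgmapDerivation.

(** * The algebra E_2 and its relations *)

Section Configuration.
Variable n : nat.
Notation EE := (ealg (gen n)).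
Implicit Types (i j : 'I_n) (u v w : EE) (a : gen n) (A B : {set gen n}).

Definition X i : EE := xg i.
Definition Y i : EE := yg i.
Definition Om i j : EE := om i j.
Definition q2 i j : EE := (X i - X j) * (Y i - Y j).
Definition d2e : EE -> EE := @d2 n.
HB.instance Definition _ := GRing.Linear.copy d2e (linext _).

Lemma X_deg1 i : X i \in deg1. Proof. exact: eg_deg1. Qed.
Lemma Y_deg1 i : Y i \in deg1. Proof. exact: eg_deg1. Qed.
Hint Extern 0 (is_true (X _ \in _)) => exact: X_deg1 : core.
Hint Extern 0 (is_true (Y _ \in _)) => exact: Y_deg1 : core.

Lemma Om_deg1 i j : Om i j \in deg1.
Proof.
rewrite /Om /om; case: insub => [w|]; first exact: eg_deg1.
by case: insub => [w|]; [exact: eg_deg1 | exact: mem0v].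
Qed.
Hint Extern 0 (is_true (Om _ _ \in _)) => exact: Om_deg1 : core.

Lemma d2gen_central a u : (d2gen a : EE) * u = u * (d2gen a : EE).
Proof.
case: a => [a|w]; first by rewrite [LHS]mul0r [RHS]mulr0.
by apply: deg1_central; apply: memvB; exact: eg_deg1.
Qed.

Lemma d2e_eg a : d2e (eg a) = d2gen a.
Proof. exact: ederiv_eg d2gen_central a. Qed.

Lemma d2e_mul u v : u \in deg1 -> d2e (u * v) = d2e u * v - u * d2e v.
Proof. exact: ederiv_deg1 d2gen_central u v. Qed.

Lemma d2e_X i : d2e (X i) = 0. Proof. exact: d2e_eg (inl (inl i)). Qed.
Lemma d2e_Y i : d2e (Y i) = 0. Proof. exact: d2e_eg (inl (inr i)). Qed.

Lemma q2C i j : q2 j i = q2 i j.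
Proof. by rewrite /q2 -(opprB (X i)) -(opprB (Y i)) mulrNN. Qed.

Lemma d2e_Om i j : i != j -> d2e (Om i j) = q2 i j.
Proof.
move=> nij; rewrite /Om /om; case: insubP => [w _ wE|/= leji].
  by rewrite [LHS]d2e_eg /= wE.
case: insubP => [w _ wE|/= leij]; first by rewrite [LHS]d2e_eg /= wE -q2C.
by case/eqP: nij; apply/val_inj/eqP; rewrite eqn_leq leqNgt leij leqNgt leji.
Qed.

Definition rhog a : EE := if isxy a then eg a else 0.

Lemma rhog_anticomm : anticomm rhog.
Proof.
move=> a b; rewrite /rhog; case: (isxy a); case: (isxy b);
  rewrite ?mulr0 ?mul0r ?oppr0 //; exact: eg_anticomm.
Qed.

Definition rho : EE -> EE := lext (wprod rhog).
HB.instance Definition _ := GRing.Linear.copy rho (lext (wprod rhog)).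

Lemma rho_mul u v : rho (u * v) = rho u * rho v.
Proof. exact: lext_mul rhog_anticomm u v. Qed.

Lemma rho_eg a : rho (eg a) = rhog a.
Proof. exact: lext_eg rhog_anticomm a. Qed.

Lemma rho_X i : rho (X i) = X i. Proof. exact: rho_eg (inl (inl i)). Qed.
Lemma rho_Y i : rho (Y i) = Y i. Proof. exact: rho_eg (inl (inr i)). Qed.

Lemma rho_Om i j : rho (Om i j) = 0.
Proof.
rewrite /Om /om; case: insub => [w|]; first exact: (rho_eg (inr w)).
by case: insub => [w|]; [exact: (rho_eg (inr w)) | exact: linear0].
Qed.

Lemma rho_q2 i j : rho (q2 i j) = q2 i j.
Proof. by rewrite rho_mul (linearB rho (X i)) (linearB rho (Y i)) /= !rho_X !rho_Y. Qed.

(* [rho] kills the omegas, so [rho_null_Iid] lets one replace a lift of an element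
   of E_2(n,E) by one in the subalgebra when computing in omega-degree 0. *)
Definition rho_null v := rho v = 0 /\ rho (d2e v) = 0.

Lemma rho_null0 : rho_null 0.
Proof. by split; rewrite ?linear0. Qed.

Lemma rho_null_lin (c : rat) u v : rho_null u -> rho_null v -> rho_null (c *: u + v).
Proof.
by move=> [u0 du0] [v0 dv0]; split; rewrite !linearP /= ?u0 ?v0 ?du0 ?dv0 scaler0 addr0.
Qed.

Lemma rho_nullD u v : rho_null u -> rho_null v -> rho_null (u + v).
Proof. by rewrite -{2}[u]scale1r; apply: rho_null_lin. Qed.

Lemma rho_null_mul u v : u \in deg1 -> rho_null v -> rho_null (u * v).
Proof.
move=> u1 [v0 dv0].
by split; rewrite ?d2e_mul // ?linearB /= !rho_mul v0 ?dv0 !mulr0 ?subr0.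
Qed.

(** Meant for u = x_i - x_j or y_i - y_j. In d_2(u omega_ij v) the only term that loses its omega_ij
    is - u q_ij v, and u q_ij = 0 since u is a factor of q_ij with square 0. *)
Lemma rho_null_xyOm u v i j : i != j -> u \in deg1 -> d2e u = 0 -> u * q2 i j = 0 ->
  rho u = u -> rho_null (u * Om i j * v).
Proof.
move=> nij u1 du uq ru; split; rewrite -mulrA; first by rewrite !rho_mul rho_Om mul0r mulr0.
rewrite d2e_mul // du mul0r sub0r linearN /= rho_mul d2e_mul // d2e_Om // linearB /=.
by rewrite (rho_mul (q2 i j)) (rho_mul (Om i j)) rho_q2 rho_Om mul0r subr0 ru mulrA uq mul0r oppr0.
Qed.

(** Each term of d_2 removes at most one of the two omegas, and [rho] kills the other. *)
Lemma rho_null_OmOm v i j k l : i != j -> k != l -> rho_null (Om i j * Om k l * v).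
Proof.
move=> nij nkl; split; rewrite -mulrA; first by rewrite !rho_mul !rho_Om !mul0r.
by rewrite d2e_mul // linearB /= !rho_mul !rho_Om !mul0r mulr0 subr0.
Qed.

Lemma X_q2 i j : (X i - X j) * q2 i j = 0.
Proof. rewrite /q2 mulrA deg1_sqr ?mul0r //. by apply: memvB. Qed.

Lemma Y_q2 i j : (Y i - Y j) * q2 i j = 0.
Proof.
rewrite /q2 mulrA [_ * (X i - X j)]deg1_anticomm ?memvB //.
by rewrite mulNr -mulrA deg1_sqr ?memvB // mulr0 oppr0.
Qed.

Lemma rho_null_rel r v : r \in rels n -> rho_null ((r : EE) * v).
Proof.
rewrite /rels mem_cat => /orP[/flattenP[_ /mapP[[i j] ij ->]]|/mapP[[[i j] k] ijk ->]].
  move: ij; rewrite mem_filter /= => /andP[nij _].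
  rewrite !inE => /orP[/eqP->|/eqP->].
    apply: (@rho_null_xyOm (X i - X j)); rewrite ?memvB ?X_q2 // linearB /= ?d2e_X ?subr0 //.
    by rewrite !rho_X.
  apply: (@rho_null_xyOm (Y i - Y j)); rewrite ?memvB ?Y_q2 // linearB /= ?d2e_Y ?subr0 //.
  by rewrite !rho_Y.
move: ijk; rewrite mem_filter /= => /andP[/and3P[nij njk nki] _].
rewrite !mulrDl; do ?apply: rho_nullD; exact: rho_null_OmOm.
Qed.

(** The right factor of a generator of the ideal is absorbed by the arbitrary v of [rho_null_rel];
    the left factor is a word, whose letters are added one at a time by [rho_null_mul]. *)
Lemma rho_null_Iid v : v \in Iid n -> rho_null v.
Proof.
move: v; apply: span_ind; first exact: rho_null0; first exact: rho_null_lin.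
move=> w /flattenP[_ /flattenP[_ /mapP[A _ ->] /mapP[r rr ->]] /mapP[B _ ->]].
have -> : emul (emul (eb A) r) (eb B) = (eb A : EE) * ((r : EE) * (eb B : EE)).
  by rewrite !emulE mulrA.
rewrite -(eb_wprod A); elim: (enum A) => [|a s IH].
  by rewrite /wprod big_nil mul1r; apply: rho_null_rel.
by rewrite /wprod big_cons -mulrA; apply: rho_null_mul => //; apply: eg_deg1.
Qed.

(** The copy of V (x) W in bidegree (1, 0); its p-th power will be the space of cocycles of bidegree
    (p, 0). *)
Definition Vdiff : {vspace EE} :=
  <<[seq (X ij.1 - X ij.2 : EE) | ij <- pairs n] ++ [seq Y ij.1 - Y ij.2 | ij <- pairs n]>>%VS.
Definition gensA : seq EE := gensE n.

Lemma gensA_deg1 : (<<gensA>> <= deg1)%VS.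
Proof.
apply/span_subvP => u; rewrite !mem_cat => /or3P[] /mapP[[i j] _ ->] /=.
- exact: (memvB (X_deg1 i) (X_deg1 j)).
- exact: (memvB (Y_deg1 i) (Y_deg1 j)).
exact: Om_deg1.
Qed.

Lemma Vdiff_gensA : (Vdiff <= <<gensA>>)%VS.
Proof. by rewrite /gensA /gensE catA span_cat; apply: addvSl. Qed.

Lemma Vdiff_deg1 : (Vdiff <= deg1)%VS.
Proof. exact: subv_trans Vdiff_gensA gensA_deg1. Qed.

Lemma X_Vdiff i j : X i - X j \in Vdiff.
Proof.
have [->|nij] := eqVneq i j; first by rewrite subrr mem0v.
apply/memv_span; rewrite mem_cat; apply/orP; left; apply/mapP; exists (i, j) => //.
by rewrite mem_filter nij; apply/allpairsP; exists (i, j); rewrite !mem_enum.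
Qed.

Lemma Y_Vdiff i j : Y i - Y j \in Vdiff.
Proof.
have [->|nij] := eqVneq i j; first by rewrite subrr mem0v.
apply/memv_span; rewrite mem_cat; apply/orP; right; apply/mapP; exists (i, j) => //.
by rewrite mem_filter nij; apply/allpairsP; exists (i, j); rewrite !mem_enum.
Qed.

Lemma Om_gensA i j : i != j -> Om i j \in <<gensA>>%VS.
Proof.
move=> nij; apply/memv_span; rewrite !mem_cat; apply/or3P; constructor 3.
apply/mapP; exists (i, j) => //.
by rewrite mem_filter nij; apply/allpairsP; exists (i, j); rewrite !mem_enum.
Qed.

Lemma q2_Vdiff i j : q2 i j \in (Vdiff ^+ 2)%VS.
Proof. by rewrite expv2; apply: memv_mul; [apply: X_Vdiff | apply: Y_Vdiff]. Qed.

Lemma rho_gensA u : u \in <<gensA>>%VS -> rho u \in Vdiff /\ rho (d2e u) \in (Vdiff ^+ 2)%VS.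
Proof.
move: u; apply: span_ind; first by rewrite !linear0 !mem0v.
  move=> c u v [u0 du] [v0 dv]; rewrite !linearP.
  by split; [exact: (memv_lin _ u0 v0)|exact: (memv_lin _ du dv)].
move=> u; rewrite !mem_cat => /or3P[] /mapP[[i j] ij ->] /=.
- rewrite [rho _](linearB rho) [d2e _](linearB d2e) /= !rho_X !d2e_X.
  rewrite subr0 linear0 mem0v; split=> //.
  exact: X_Vdiff.
- rewrite [rho _](linearB rho) [d2e _](linearB d2e) /= !rho_Y !d2e_Y.
  rewrite subr0 linear0 mem0v; split=> //.
  exact: Y_Vdiff.
move: ij; rewrite mem_filter /= => /andP[nij _].
by rewrite rho_Om mem0v d2e_Om // rho_q2 q2_Vdiff.
Qed.

(** The exponent grows by one because d_2 replaces one factor omega_ij by q_ij, which lies in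
    [Vdiff ^+ 2]. *)
Lemma rho_gensA_expv k u : u \in (<<gensA>> ^+ k)%VS ->
  rho u \in (Vdiff ^+ k)%VS /\ rho (d2e u) \in (Vdiff ^+ k.+1)%VS.
Proof.
elim: k u => [u|k IH].
  rewrite expv0 => /vlineP[c ->]; rewrite !linearZ /=.
  have -> : (1 : EE) = wprod eg [::] by rewrite /wprod big_nil.
  rewrite /d2e [d2 _](lext_word _ (alt_dword d2gen_central)) linear0 scaler0 mem0v.
  by rewrite [rho _]lext_word /wprod ?big_nil ?memvZ ?memv_line //; apply/alt_wprod/rhog_anticomm.
rewrite expvSl; apply: prodv_ind; first by rewrite !linear0 !mem0v.
  move=> c u v [u0 du] [v0 dv]; rewrite !linearP.
  by split; [exact: (memv_lin _ u0 v0)|exact: (memv_lin _ du dv)].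
move=> u v uE /IH[rv rdv]; have [ru rdu] := rho_gensA uE.
rewrite d2e_mul ?(subvP gensA_deg1) // linearB /= !rho_mul; split.
  by rewrite expvSl memv_mul.
apply: memvB; last by rewrite expvSl memv_mul.
by rewrite (expvD _ 2 k) memv_mul.
Qed.

End Configuration.

(** * Bidegrees and cocycles *)

Section Bidegree.
Variable n : nat.
Notation EE := (ealg (gen n)).
Notation Vbi p q := (Vbideg n p q : {vspace EE}).
Implicit Types (i j : 'I_n) (u v w : EE) (a : gen n) (A B : {set gen n}).

Lemma memVbidegP p q v :
  reflect (forall A, bideg A != (p, q) -> v A = 0) (v \in Vbi p q).
Proof.
apply: (iffP idP) => [|v0].
  move: v; apply: span_ind => [A _|c u v u0 v0 A nA|u /mapP[B pqB ->] A nA].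
  - by rewrite ffunE.
  - by rewrite !ffunE u0 ?v0 // scaler0 addr0.
  move: pqB; rewrite mem_filter => /andP[/eqP pqB _]; rewrite ffunE.
  by case: (A =P B) nA => // ->; rewrite pqB eqxx.
rewrite [v]ext_sum_eb; apply: memv_suml => A _.
have [pqA|/v0->] := eqVneq (bideg A) (p, q); last by rewrite scale0r mem0v.
by apply/memvZ/memv_span/map_f; rewrite mem_filter pqA eqxx mem_enum inE.
Qed.

Lemma eb_Vbideg A : (eb A : EE) \in Vbi (bideg A).1 (bideg A).2.
Proof.
apply/memVbidegP=> B nB; rewrite ffunE.
by case: (B =P A) nB => // ->; rewrite -surjective_pairing eqxx.
Qed.

Lemma Vbideg_ind p q (P : EE -> Prop) :
    P 0 -> (forall c u v, P u -> P v -> P (c *: u + v)) ->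
    (forall A, bideg A = (p, q) -> P (eb A)) ->
  forall v, v \in Vbi p q -> P v.
Proof.
move=> P0 Plin Peb; apply: span_ind => // _ /mapP[A pqA ->]; apply: Peb.
by move: pqA; rewrite mem_filter => /andP[/eqP].
Qed.

Definition bipart p q (v : EE) : EE := [ffun A => if bideg A == (p, q) then v A else 0].

Fact bipart_is_linear p q : linear (bipart p q).
Proof.
move=> c u v; apply/ffunP=> A; rewrite !ffunE; case: ifP => // _.
by rewrite scaler0 addr0.
Qed.
HB.instance Definition _ p q :=
  GRing.isLinear.Build rat EE EE *:%R (bipart p q) (bipart_is_linear p q).

Lemma bipart_Vbideg p q p' q' v : v \in Vbi p q ->
  bipart p' q' v = if (p, q) == (p', q') then v else 0.
Proof.
move/memVbidegP=> v0; apply/ffunP=> A; rewrite ffunE.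
have [pqA|npqA] := eqVneq (bideg A) (p, q); first by rewrite pqA; case: ifP; rewrite ?ffunE.
by rewrite (v0 A) // if_same; case: ifP; rewrite ?ffunE ?v0.
Qed.

Lemma Vbideg_mul p q p' q' u v : u \in Vbi p q -> v \in Vbi p' q' ->
  u * v \in Vbi (p + p') (q + q').
Proof.
move=> + vV; move: u; apply: Vbideg_ind => [|c u w uE wE|A [pA qA]].
- by rewrite mul0r mem0v.
- by rewrite mulrDl -scalerAl; apply: (memv_lin _ uE wE).
move: v vV; apply: Vbideg_ind => [|c v w vE wE|B [pB qB]].
- by rewrite mulr0 mem0v.
- by rewrite mulrDr -scalerAr; apply: (memv_lin _ vE wE).
rewrite [_ * _]xb_mul; case: ifPn => [/eqP AB0|_]; last exact: mem0v.
have UE (P : pred (gen n)) :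
    #|[set a in A :|: B | P a]| = (#|[set a in A | P a]| + #|[set a in B | P a]|)%N.
  rewrite -cardsUI; set I := (X in (_ + #|pred_of_set X|)%N); have -> : I = set0.
    apply/setP=> a; have := in_set0 a; rewrite -AB0 !inE /=.
    by case: (a \in A); case: (a \in B); rewrite //= ?andbF.
  rewrite cards0 addn0; apply: eq_card => a; rewrite !inE /=.
  by case: (a \in A); case: (a \in B); rewrite ?orbb ?orbF.
by apply: memvZ; have := eb_Vbideg (A :|: B); rewrite /= !UE pA qA pB qB.
Qed.

Lemma one_Vbideg : (1 : EE) \in Vbi 0 0.
Proof.
have E0 (P : pred (gen n)) : #|[set b in set0 | P b]| = 0%N.
  by apply: eq_card0 => b; rewrite !inE.
by have := eb_Vbideg set0; rewrite /= !E0.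
Qed.

Lemma eg_Vbideg a : eg a \in Vbi (isxy a) (~~ isxy a).
Proof.
have E (P : pred (gen n)) : #|[set b in [set a] | P b]| = P a.
  case Pa: (P a); [apply: etrans (cards1 a)|apply: etrans (cards0 (gen n))]; apply: eq_card => b;
  by rewrite !inE; case: eqP => // ->.
by have := eb_Vbideg [set a]; rewrite /= !E.
Qed.

Lemma wprod_Vbideg s :
  wprod eg s \in Vbi (count (@isxy n) s) (count (predC (@isxy n)) s).
Proof.
elim: s => [|a s IH]; first by rewrite /wprod big_nil one_Vbideg.
by rewrite /wprod big_cons /= Vbideg_mul ?eg_Vbideg.
Qed.

Lemma X_Vbideg i : X i \in Vbi 1 0. Proof. exact: (eg_Vbideg (inl (inl i))). Qed.
Lemma Y_Vbideg i : Y i \in Vbi 1 0. Proof. exact: (eg_Vbideg (inl (inr i))). Qed.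
Lemma Om_Vbideg i j : Om i j \in Vbi 0 1.
Proof.
rewrite /Om /om; case: insub => [w|]; first exact: (eg_Vbideg (inr w)).
by case: insub => [w|]; [exact: (eg_Vbideg (inr w)) | exact: mem0v].
Qed.

Lemma d2gen_Vbideg a : (d2gen a : EE) \in Vbi 2 0.
Proof.
case: a => [a|w]; first exact: mem0v.
by apply: (@Vbideg_mul 1 0 1 0); apply: memvB; exact: eg_Vbideg.
Qed.

Lemma dword_Vbideg0 s : count (predC (@isxy n)) s = 0%N -> dword (@d2gen n) s = 0.
Proof.
elim: s => // -[a|w] s IH // c0; rewrite dword_cons IH // mulr0 subr0.
by rewrite [LHS]mul0r.
Qed.

Lemma dword_Vbideg1 s : count (predC (@isxy n)) s = 1%N ->
  (dword (@d2gen n) s : EE) \in Vbi (count (@isxy n) s).+2 0.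
Proof.
elim: s => // -[a|w] s IH c1; rewrite dword_cons.
  rewrite [_ * _]mul0r sub0r memvN.
  by apply: (@Vbideg_mul 1 0 _ 0); [exact: eg_Vbideg|exact: IH].
case: c1 => c0; rewrite dword_Vbideg0 // mulr0 subr0.
apply: (@Vbideg_mul 2 0 _ 0); first exact: (d2gen_Vbideg (inr w)).
by have := wprod_Vbideg s; rewrite -[count (predC _) s]add0n c0.
Qed.

Lemma count_enum (P : pred (gen n)) A : count P (enum A) = #|[set a in A | P a]|.
Proof.
rewrite -size_filter -(card_uniqP (filter_uniq _ (enum_uniq _))).
by apply: eq_card => a; rewrite !inE mem_filter mem_enum andbC.
Qed.

Lemma d2e_eb A : d2e (eb A) = dword (@d2gen n) (enum A).
Proof. exact: lext_eb. Qed.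

Lemma d2e_Vbideg0 p v : v \in Vbi p 0 -> d2e v = 0.
Proof.
move: v; apply: Vbideg_ind => [|c u v u0 v0|A [_ A0]].
- exact: linear0.
- by rewrite linearP /= u0 v0 scaler0 addr0.
by rewrite d2e_eb dword_Vbideg0 // count_enum.
Qed.

Lemma d2e_Vbideg1 p v : v \in Vbi p 1 -> d2e v \in Vbi p.+2 0.
Proof.
move: v; apply: Vbideg_ind => [|c u v u0 v0|A [pA A0]].
- by rewrite linear0 mem0v.
- by rewrite linearP; exact: (memv_lin _ u0 v0).
by rewrite d2e_eb -pA -count_enum dword_Vbideg1 // count_enum.
Qed.

Lemma rho_Vbideg0 p v : v \in Vbi p 0 -> rho v = v.
Proof.
move: v; apply: Vbideg_ind => [|c u v u0 v0|A [_ A0]].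
- exact: linear0.
- by rewrite linearP /= u0 v0.
rewrite [LHS]lext_eb -[RHS]eb_wprod; apply: eq_big_seq => a.
rewrite mem_enum => aA; rewrite /rhog; case: ifPn => // na.
by have := in_set0 a; rewrite -(cards0_eq A0) inE aA na.
Qed.

Lemma Vdiff_Vbideg : (Vdiff n <= Vbi 1 0)%VS.
Proof.
apply/span_subvP => u; rewrite mem_cat => /orP[] /mapP[[i j] _ ->] /=.
  by apply: memvB; exact: X_Vbideg.
by apply: memvB; exact: Y_Vbideg.
Qed.

Lemma Vdiffp_Vbideg p : (Vdiff n ^+ p <= Vbi p 0)%VS.
Proof.
elim: p => [|p IH]; first by rewrite expv0 -memvE one_Vbideg.
rewrite expvSl; apply/prodvP => u v /(subvP Vdiff_Vbideg) u1 /(subvP IH) vp.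
exact: (Vbideg_mul u1 vp).
Qed.

Lemma bipart_Vdiffp p r u : u \in (Vdiff n ^+ p)%VS -> bipart r 0 u \in (Vdiff n ^+ r)%VS.
Proof.
move=> up; rewrite (bipart_Vbideg _ _ (subvP (Vdiffp_Vbideg p) _ up)).
by case: eqP => [[<-]|]; rewrite ?mem0v.
Qed.

(** An element of the subalgebra mixes words of all lengths. After [rho], words of length k have
    bidegree (k, 0), and their differentials (k + 1, 0), so [bipart r 0] selects a single length. *)
Lemma subalg_Iid_rho r v : v \in (subalg (gensE n) + Iid n)%VS ->
  bipart r 0 (rho v) \in (Vdiff n ^+ r)%VS /\ bipart r 0 (rho (d2e v)) \in (Vdiff n ^+ r)%VS.
Proof.
case/memv_addP=> s sS [t /rho_null_Iid[t0 dt0] ->].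
rewrite !linearD /= t0 dt0 !linear0 !addr0.
move: s sS; apply: subalg_ind => [|c u w [u0 du] [w0 dw]|k u /rho_gensA_expv[ru rdu]].
- by rewrite !linear0 !mem0v.
- by rewrite !linearP; split; [exact: (memv_lin _ u0 w0)|exact: (memv_lin _ du dw)].
by split; apply: bipart_Vdiffp; [exact: ru | exact: rdu].
Qed.

(** An element of bidegree (p, 0) is fixed by [rho] and by [bipart p 0], so [subalg_Iid_rho] speaks
    of the element itself. Conversely d_2 vanishes where there is no omega. *)
Lemma E3cycE p : E3cyc n p 0 = (Vdiff n ^+ p)%VS.
Proof.
apply/eqP; rewrite eqEsubv; apply/andP; split; apply/subvP => v.
  rewrite /E3cyc /E2lift !memv_cap => /andP[/andP[/(subalg_Iid_rho p)[+ _] vV] _].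
  by rewrite (rho_Vbideg0 vV) (bipart_Vbideg _ _ vV) eqxx.
move=> vp; have vV := subvP (Vdiffp_Vbideg p) _ vp.
rewrite /E3cyc /E2lift !memv_cap vV andbT; apply/andP; split.
  apply: (subvP (addvSl _ _)); apply: (subvP (expv_subalg p (@gensA_deg1 n))).
  exact: (subvP (expvS p (@Vdiff_gensA n))).
by rewrite -memv_preim lfunE [X in X \in _](d2e_Vbideg0 vV) mem0v.
Qed.

Lemma d2f_E2lift p v : v \in E2lift n p 1 -> d2e v \in (Vdiff n ^+ p.+2)%VS.
Proof.
rewrite memv_cap => /andP[/(subalg_Iid_rho p.+2)[_ +] vV].
have dV := d2e_Vbideg1 vV.
by rewrite (rho_Vbideg0 dV) (bipart_Vbideg _ _ dV) eqxx.
Qed.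

Lemma Ipq0 p : Ipq n p 0 = 0%VS.
Proof.
apply/eqP; rewrite -subv0; apply/subvP => v; rewrite memv_cap => /andP[/rho_null_Iid[+ _] vV].
by rewrite (rho_Vbideg0 vV) => ->; exact: mem0v.
Qed.

End Bidegree.

(** * The morphism phi and the sums over colourings *)

Section Target.
Variable n : nat.
Notation EE := (ealg (gen n)).
Notation VV := (ealg 'I_n).
Notation PP := {mpoly rat[2]}.
Notation TT := (xalg PP 'I_n).
Implicit Types (i j : 'I_n) (v w : VV) (P Q : PP).

Definition ten w P : TT := tens w P.

Lemma ten_mul v w P Q : ten v P * ten w Q = ten (v * w) (P * Q).
Proof.
apply/ffunP=> C; rewrite !ffunE scaler_suml; apply: eq_bigr => A _.
rewrite scaler_suml; apply: eq_bigr => B _; rewrite !ffunE.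
case: ifP => _; last by rewrite scale0r.
(* The sign is a polynomial on one side and a rational on the other; reducing the exponents to their
   parity makes them comparable. *)
rewrite -[in LHS]signr_odd -[in RHS]signr_odd /=.
by case: (odd _); rewrite ?expr0 ?expr1 ?mul1r ?mulN1r ?mulNr ?scaleNr
  -scalerAr -scalerAl scalerA [w B * v A]mulrC.
Qed.

Lemma ten_one : ten 1 1 = 1.
Proof.
apply/ffunP=> A; rewrite !ffunE; case: eqP => _; rewrite ?scale1r ?scale0r //.
Qed.

Lemma ten_linl P c v w : ten (c *: v + w) P = c *: ten v P + ten w P.
Proof. by apply/ffunP=> A; rewrite !ffunE scalerDl scalerA. Qed.

Lemma ten_linr v c P Q : ten v (c *: P + Q) = c *: ten v P + ten v Q.
Proof. by apply/ffunP=> A; rewrite !ffunE scalerDr !scalerA mulrC. Qed.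

Lemma ten0l P : ten 0 P = 0.
Proof. by apply/ffunP=> A; rewrite !ffunE scale0r. Qed.

Lemma ten0r v : ten v 0 = 0.
Proof. by apply/ffunP=> A; rewrite !ffunE scaler0. Qed.

Lemma tenZl c v P : ten (c *: v) P = c *: ten v P.
Proof. by rewrite -[c *: v]addr0 ten_linl ten0l addr0. Qed.

Lemma tenZr c v P : ten v (c *: P) = c *: ten v P.
Proof. by rewrite -[c *: P]addr0 ten_linr ten0r addr0. Qed.

Lemma tenDl v w P : ten (v + w) P = ten v P + ten w P.
Proof. by rewrite -{1}[v]scale1r ten_linl scale1r. Qed.

Lemma tenDr v P Q : ten v (P + Q) = ten v P + ten v Q.
Proof. by rewrite -{1}[P]scale1r ten_linr scale1r. Qed.

Lemma tenNl v P : ten (- v) P = - ten v P.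
Proof. by rewrite -scaleN1r tenZl scaleN1r. Qed.

Definition phig (a : gen n) : TT :=
  match a with
  | inl (inl i) => ten (eg i) 'X_ord0
  | inl (inr i) => ten (eg i) 'X_ord_max
  | inr _ => 0
  end.

Lemma ten_eg_anticomm i j P Q : ten (eg i) P * ten (eg j) Q = - (ten (eg j) Q * ten (eg i) P).
Proof. by rewrite !ten_mul eg_anticomm tenNl [P * Q]mulrC. Qed.

Lemma phig_anticomm : anticomm phig.
Proof.
by move=> [[i|i]|a] [[j|j]|b] /=; rewrite ?mulr0 ?mul0r ?oppr0 //; apply: ten_eg_anticomm.
Qed.

Definition phi : EE -> TT := lext (wprod phig).
HB.instance Definition _ := GRing.Linear.copy phi (lext (wprod phig)).

Lemma phi_mul (u u' : EE) : phi (u * u') = phi u * phi u'.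
Proof. exact: lext_mul phig_anticomm u u'. Qed.

Lemma phi_eg a : phi (eg a) = phig a.
Proof. exact: lext_eg phig_anticomm a. Qed.

Lemma phi_one : phi 1 = 1.
Proof. exact: lext_one phig_anticomm. Qed.

Lemma phi_X i : phi (X i) = ten (eg i) 'X_ord0. Proof. exact: phi_eg (inl (inl i)). Qed.
Lemma phi_Y i : phi (Y i) = ten (eg i) 'X_ord_max. Proof. exact: phi_eg (inl (inr i)). Qed.

Lemma phi_Om i j : phi (Om i j) = 0.
Proof.
rewrite /Om /om; case: insub => [w|]; first exact: (phi_eg (inr w)).
by case: insub => [w|]; [exact: (phi_eg (inr w)) | exact: linear0].
Qed.

Lemma phi_q2 i j : phi (q2 i j) = 0.
Proof.
rewrite phi_mul !linearB /= !phi_X !phi_Y -!tenNl -!tenDl ten_mul deg1_sqr ?ten0l //.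
by apply: memvB; apply: eg_deg1.
Qed.

Lemma phi_d2e (u : EE) : phi (d2e u) = 0.
Proof.
suff phi_dword s : phi (dword (@d2gen n) s) = 0.
  rewrite [d2e u]/(lext (dword (@d2gen n)) u) linear_sum big1 // => A _.
  by rewrite linearZ /= phi_dword scaler0.
elim: s => [|a s IH]; first exact: linear0.
rewrite dword_cons linearB /= !phi_mul IH mulr0 subr0.
case: a => [a|[[i j] ij]]; last by rewrite [phi _](phi_q2 i j) mul0r.
by rewrite [phi _](linear0 phi) mul0r.
Qed.

(** No colouring has -1 letters y: the value 0 at k = 0 keeps the recursion for colourings uniform
    in k. *)
Definition colword_pred (F : nat -> EE) k : EE := if k is k'.+1 then F k' else 0.

(* The sum, over all colourings of the letters i of s by x or y with exactly k
   letters y, of the product of the corresponding x_i and y_i. *)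
Fixpoint colword (s : seq 'I_n) (k : nat) : EE :=
  if s is i :: s' then X i * colword s' k + Y i * colword_pred (colword s') k else (k == 0%N)%:R.

(** For the letters i and j, the colourings x x and y y change sign by themselves, while x y and y x
    are interchanged: X i * Y j = - (Y j * X i), which up to sign is a mixed colouring of the
    exchanged word. *)
Lemma alt_colword k : alternating (fun s => colword s k).
Proof.
move=> s1 i j s2; elim: s1 k => [|l s1 IH] k; last first.
  rewrite /= IH mulrN; case: k => [|k] /=; first by rewrite !mulr0 !addr0.
  by rewrite IH mulrN opprD.
have xlin := deg1_anticomm (X_deg1 i) (X_deg1 j).
have ylin := deg1_anticomm (Y_deg1 i) (Y_deg1 j).
have XY := deg1_anticomm (X_deg1 i) (Y_deg1 j).
have YX := deg1_anticomm (Y_deg1 i) (X_deg1 j).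
rewrite /=; move: (X i) (X j) (Y i) (Y j) xlin ylin XY YX => a b c d ab cd ad cb.
case: k => [|k] /=; first by rewrite !mulr0 !addr0 !mulrA ab mulNr.
rewrite !mulrDr !mulrA ab ad cb cd !mulNr.
move: (b * a * _) (d * a * _) (b * c * _) (d * c * _) => e f g h.
rewrite !opprD -!addrA; congr (_ + _).
by rewrite addrCA.
Qed.

Definition colsum k : VV -> EE := lext (fun s => colword s k).
HB.instance Definition _ k := GRing.Linear.copy (colsum k) (lext (fun s => colword s k)).

Lemma X_anticomm : anticomm (@X n).
Proof. by move=> i j; apply: deg1_anticomm; apply: X_deg1. Qed.
Lemma Y_anticomm : anticomm (@Y n).
Proof. by move=> i j; apply: deg1_anticomm; apply: Y_deg1. Qed.

(** In degree 1, [xlin] and [ylin] are the embeddings v |-> v x and v |-> v y, with which an element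
    of V(1) is given a colour. *)
Definition xlin : VV -> EE := lext (wprod (@X n)).
HB.instance Definition _ := GRing.Linear.copy xlin (lext (wprod (@X n))).
Definition ylin : VV -> EE := lext (wprod (@Y n)).
HB.instance Definition _ := GRing.Linear.copy ylin (lext (wprod (@Y n))).

Lemma xlin_eg i : xlin (eg i) = X i. Proof. exact: lext_eg X_anticomm i. Qed.
Lemma ylin_eg i : ylin (eg i) = Y i. Proof. exact: lext_eg Y_anticomm i. Qed.

Lemma colsum_mul k v w : v \in deg1 ->
  colsum k (v * w) = xlin v * colsum k w + ylin v * colword_pred (fun k => colsum k w) k.
Proof.
move: v; apply: span_ind => [|c u v uE vE|_ /mapP[i _ ->]].
- by rewrite mul0r !linear0 !mul0r addr0.
- rewrite mulrDl -scalerAl !linearP /= uE vE.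
  move: (xlin u) (xlin v) (ylin u) (ylin v) (colsum k w) (colword_pred _ _) => a b d e f g.
  by rewrite !mulrDl -!scalerAl scalerDr addrACA.
rewrite xlin_eg ylin_eg.
have FE k' : colsum k' w = \sum_A w A *: colword (enum A) k'.
  by rewrite /colsum /lext.
have -> : colword_pred (fun k => colsum k w) k = \sum_A w A *: colword_pred (colword (enum A)) k.
  by case: k => [|k] /=; rewrite ?FE //= big1 // => A _; rewrite scaler0.
rewrite FE [w in LHS]ext_sum_eb !mulr_sumr linear_sum -big_split; apply: eq_bigr => A _ /=.
rewrite -!scalerAr linearZ /= -scalerDr -eb_wprod; congr (_ *: _).
have -> : eg i * wprod eg (enum A) = wprod eg (i :: enum A).
  by rewrite /wprod big_cons.
by rewrite [LHS]lext_word //; apply: alt_colword.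
Qed.

Lemma colsum_one k : colsum k 1 = (k == 0%N)%:R.
Proof.
have -> : (1 : VV) = wprod eg [::] by rewrite /wprod big_nil.
by rewrite [LHS]lext_word //; apply: alt_colword.
Qed.

Definition V1 : {vspace VV} := <<V1gens n>>%VS.

Lemma LamV1E p : LamV1 n p = (V1 ^+ p)%VS.
Proof. by rewrite -span_twords. Qed.

Lemma V1_ind (P : VV -> Prop) :
    P 0 -> (forall c u v, P u -> P v -> P (c *: u + v)) ->
    (forall i j, P (eg i - eg j)) ->
  forall v, v \in V1 -> P v.
Proof. by move=> P0 Plin PV; apply: span_ind => // _ /allpairsP[[i j] [_ _ ->]]. Qed.

Lemma V1_deg1 : (V1 <= deg1)%VS.
Proof.
apply/subvP; apply: V1_ind => [|c u v u1 v1|i j]; first exact: mem0v.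
  exact: (memv_lin _ u1 v1).
by apply: memvB; exact: eg_deg1.
Qed.

Lemma xlin_Vdiff v : v \in V1 -> xlin v \in Vdiff n.
Proof.
move: v; apply: V1_ind => [|c u v u1 v1|i j].
- by rewrite linear0 mem0v.
- by rewrite linearP; exact: (memv_lin _ u1 v1).
by rewrite linearB /= !xlin_eg X_Vdiff.
Qed.

Lemma ylin_Vdiff v : v \in V1 -> ylin v \in Vdiff n.
Proof.
move: v; apply: V1_ind => [|c u v u1 v1|i j].
- by rewrite linear0 mem0v.
- by rewrite linearP; exact: (memv_lin _ u1 v1).
by rewrite linearB /= !ylin_eg Y_Vdiff.
Qed.

Lemma colsum_Vdiffp k p w : w \in (V1 ^+ p)%VS -> colsum k w \in (Vdiff n ^+ p)%VS.
Proof.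
elim: p k w => [|p IH] k w.
  rewrite expv0 => /vlineP[c ->]; rewrite linearZ /= colsum_one memvZ //.
  by case: eqP; rewrite ?mem0v ?expv0 ?memv_line.
rewrite expvSl; move: w; apply: prodv_ind => [|c u v u1 v1|v w v1 wp].
- by rewrite linear0 mem0v.
- by rewrite linearP; exact: (memv_lin _ u1 v1).
rewrite colsum_mul ?(subvP V1_deg1) // expvSl memvD ?memv_mul ?xlin_Vdiff ?ylin_Vdiff ?IH //.
by case: k => [|k] /=; rewrite ?mem0v ?IH.
Qed.

(* Only meaningful for k <= p, the subtraction being truncated. *)
Definition mnm2 p k : 'X_{1..2} := [multinom (if i == ord0 then p - k else k)%N | i < 2].
Definition mon p k : PP := 'X_[mnm2 p k].

Lemma mon_X0 p k : (k <= p)%N -> 'X_ord0 * mon p k = mon p.+1 k.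
Proof.
move=> le_kp; rewrite /mon -mpolyXD; congr 'X_[_].
apply/mnmP=> i; rewrite mnmDE !mnmE eq_sym.
by case: eqP => _ /=; rewrite ?add0n // add1n subSn.
Qed.

Lemma mon_X1 p k : 'X_ord_max * mon p k = mon p.+1 k.+1.
Proof.
rewrite /mon -mpolyXD; congr 'X_[_].
apply/mnmP=> i; rewrite mnmDE !mnmE eq_sym -val_eqE -[_ == ord0]val_eqE /= subSS.
by case: i => [[|[|i]]] //= _; rewrite add0n.
Qed.

(** All colourings with k letters y have the same image, since X0 and X1 commute. In the induction,
    the two colours of the first factor give the two terms of Pascal's rule [binS]. *)
Lemma phi_colsum k p w : w \in (V1 ^+ p)%VS ->
  phi (colsum k w) = ('C(p, k)%:R : rat) *: ten w (mon p k).
Proof.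
have phiX v : v \in V1 -> phi (xlin v) = ten v 'X_ord0.
  move: v; apply: V1_ind => [|c u v u1 v1|i j].
  - by rewrite !linear0 ten0l.
  - by rewrite !linearP /= ten_linl u1 v1.
  by rewrite !linearB /= !xlin_eg !phi_X tenDl tenNl.
have phiY v : v \in V1 -> phi (ylin v) = ten v 'X_ord_max.
  move: v; apply: V1_ind => [|c u v u1 v1|i j].
  - by rewrite !linear0 ten0l.
  - by rewrite !linearP /= ten_linl u1 v1.
  by rewrite !linearB /= !ylin_eg !phi_Y tenDl tenNl.
elim: p k w => [|p IH] k w.
  rewrite expv0 => /vlineP[c ->]; rewrite !linearZ /= colsum_one tenZl.
  case: k => [|k] /=; last by rewrite linear0 !scaler0 scale0r.
  rewrite phi_one scale1r -ten_one; congr (_ *: ten _ _).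
  by rewrite /mon -mpolyX0; congr 'X_[_]; apply/mnmP=> i; rewrite !mnmE if_same.
rewrite expvSl; move: w; apply: prodv_ind => [|c u v u1 v1|v w v1 wp].
- by rewrite !linear0 ten0l scaler0.
- by rewrite !linearP /= u1 v1 ten_linl scalerDr !scalerA mulrC.
rewrite colsum_mul ?(subvP V1_deg1) // linearD /= !phi_mul phiX // phiY // IH //.
rewrite -scalerAr ten_mul; case: k => [|k] /=.
  by rewrite linear0 mulr0 addr0 !bin0 mon_X0.
rewrite IH // -scalerAr ten_mul mon_X1 binS natrD scalerDl; congr (_ + _).
(* Where the subtraction in [mnm2] would be truncated, the coefficient 'C(p, k.+1) is 0. *)
have [/mon_X0->//|ltpk] := leqP k.+1 p; by rewrite bin_small // !scale0r.
Qed.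

End Target.

(** * Exchanging colours modulo coboundaries *)

Section Decomposition.
Variable n : nat.
Notation EE := (ealg (gen n)).
Notation VV := (ealg 'I_n).
Implicit Types (i j : 'I_n) (u : EE) (v w : VV).
Notation Vdiff := (Vdiff n).
Notation V1 := (V1 n).

Definition Vq2 : {vspace EE} := <<[seq q2 ij.1 ij.2 | ij <- pairs n]>>%VS.
(** The degree-p part of the ideal generated by the q_ij in the algebra generated by [Vdiff];
    one-sided products suffice because the q_ij are central. *)
Definition swapI p : {vspace EE} := if p is p'.+2 then (Vq2 * Vdiff ^+ p')%VS else 0%VS.

Lemma q2_Vq2 i j : q2 i j \in Vq2.
Proof.
have [->|nij] := eqVneq i j; first by rewrite /q2 subrr mul0r mem0v.
apply/memv_span/mapP; exists (i, j) => //.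
by rewrite mem_filter nij; apply/allpairsP; exists (i, j); rewrite !mem_enum.
Qed.

Lemma Vq2_central q u : q \in Vq2 -> q * u = u * q.
Proof.
move: q; apply: span_ind => [|c q r qE rE|_ /mapP[[i j] _ ->]].
- by rewrite mul0r mulr0.
- by rewrite mulrDl mulrDr -scalerAl -scalerAr qE rE.
by apply: deg1_central; apply: memvB; exact: eg_deg1.
Qed.

Lemma swapI_mul p u u' : u \in Vdiff -> u' \in swapI p -> u * u' \in swapI p.+1.
Proof.
move=> uV; case: p => [|[|p]] /=; try by rewrite memv0 => /eqP ->; rewrite mulr0 mem0v.
move: u'; apply: prodv_ind => [|c q r qE rE|q r qQ rV].
- by rewrite mulr0 mem0v.
- by rewrite mulrDr -scalerAr; exact: (memv_lin _ qE rE).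
by rewrite mulrA -(Vq2_central u qQ) -mulrA memv_mul // expvSl memv_mul.
Qed.

Lemma swapI_Vdiffp p : (swapI p <= Vdiff ^+ p)%VS.
Proof.
case: p => [|[|p]] /=; rewrite ?sub0v // (expvD _ 2 p); apply: prodvSl.
by apply/span_subvP => _ /mapP[[i j] _ ->]; apply: q2_Vdiff.
Qed.

(* Polarization: the squares of the e_i - e_j span Sym^2 V(1). *)
Lemma xlin_ylin_sym v w : v \in V1 -> w \in V1 -> xlin v * ylin w + xlin w * ylin v \in Vq2.
Proof.
move=> + wV; move: v; apply: V1_ind => [|c u v u1 v1|i j].
- by rewrite !linear0 mul0r mulr0 addr0 mem0v.
- rewrite !linearP /= mulrDl mulrDr -scalerAl -scalerAr addrACA -scalerDr.
  exact: (memv_lin _ u1 v1).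
move: w wV; apply: V1_ind => [|c u v u1 v1|k l].
- by rewrite !linear0 mul0r mulr0 addr0 mem0v.
- rewrite !linearP /= mulrDl mulrDr -scalerAl -scalerAr addrACA -scalerDr.
  exact: (memv_lin _ u1 v1).
rewrite !linearB /= !xlin_eg !ylin_eg.
(* Let Q(u) = (u x)(u y), with polar form B. The left side is B(e_i - e_j, e_k - e_l); inserting
   Q(e_a - e_b) = Q(e_a) + Q(e_b) - B(e_a, e_b) on the right, the Q(e_a) cancel. *)
have -> : (X i - X j) * (Y k - Y l) + (X k - X l) * (Y i - Y j) =
    q2 i l + q2 j k - q2 i k - q2 j l.
  rewrite /q2; move: (X i) (X j) (X k) (X l) (Y i) (Y j) (Y k) (Y l) => a b c d e f g h.
  by rewrite !mulrBl !mulrBr; apply/ffunP=> A; rewrite !ffunE; ring.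
by rewrite !(memvB, memvD) ?q2_Vq2.
Qed.

End Decomposition.

Section ScalarIdentities.
Variables (T : finType) (e f g h : {ffun T -> rat^o}) (P K : rat).

(** Linear identities between elements of the noncommutative algebra are checked coefficientwise,
    where [ring] and [field] apply. [P] and [K] stand for the numbers p and k. *)
Lemma swap_identity :
  (K + 1) *: (- e + g) - (P + 1 - K) *: (- f - h) =
  g + f - ((K + 1) *: e - (P - K) *: f) - (K *: - g - (P + 1 - K) *: h).
Proof.
apply/ffunP=> A; rewrite !ffunE; move: (e A) (f A) (g A) (h A) => a b c d.
rewrite /GRing.scale /=; ring.
Qed.

(** Solves for f the linear system whose data are e + f, a colour sum, and (K + 1) e - (P - K) f, an
    element of [swapI]. Its determinant is -(P + 1). *)
Lemma colour_identityY : P + 1 != 0 ->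
  f = - ((P + 1)^-1 *: ((K + 1) *: e - (P - K) *: f)) + ((K + 1) / (P + 1)) *: (e + f).
Proof.
move=> P0; apply/ffunP=> A; rewrite !ffunE; move: (e A) (f A) => a b.
by rewrite /GRing.scale /=; field.
Qed.

Lemma colour_identityX : P + 1 != 0 ->
  e = (P + 1)^-1 *: ((K + 1) *: e - (P - K) *: f) + ((P + 1 - (K + 1)) / (P + 1)) *: (e + f).
Proof.
move=> P0; apply/ffunP=> A; rewrite !ffunE; move: (e A) (f A) => a b.
by rewrite /GRing.scale /=; field.
Qed.

End ScalarIdentities.

Section ColourSwap.
Variable n : nat.
Notation EE := (ealg (gen n)).
Notation VV := (ealg 'I_n).
Implicit Types (i j : 'I_n) (u : EE) (v w : VV).
Notation Vdiff := (Vdiff n).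
Notation V1 := (V1 n).
Notation Vq2 := (Vq2 n).
Notation swapI := (swapI n).

(* Modulo [swapI], [colsum k w] is 'C(p, k) times any single colouring of w, and
   k.+1 * 'C(p, k.+1) = (p - k) * 'C(p, k). *)
Lemma XY_swap p k v w : v \in V1 -> w \in (V1 ^+ p)%VS ->
  k.+1%:R *: (xlin v * colsum k.+1 w) - (p%:R - k%:R) *: (ylin v * colsum k w) \in swapI p.+1.
Proof.
have XXY v' w' : v' \in V1 -> w' \in V1 -> ylin v' * xlin w' = - (xlin w' * ylin v').
  move=> v1 w1; apply: deg1_anticomm; apply: (subvP (@Vdiff_deg1 n)).
    exact: ylin_Vdiff.
  exact: xlin_Vdiff.
elim: p k v w => [|p IH] k v w vV.
  rewrite expv0 => /vlineP[c ->]; rewrite !linearZ /= !colsum_one /= scaler0 mulr0 scaler0.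
  case: k => [|k]; first by rewrite (subrr (0%:R : rat)) scale0r addr0 mem0v.
  by rewrite /= scaler0 mulr0 oppr0 scaler0 addr0 mem0v.
rewrite expvSl; move: w; apply: prodv_ind => [|c u w uE wE|w u wV uV].
- by rewrite !linear0 !mulr0 !scaler0 subr0 mem0v.
- rewrite (linearP (colsum k.+1)) (linearP (colsum k)) /=.
  move: (xlin v) (ylin v) (colsum _ _) (colsum _ _) (colsum _ _) (colsum _ _) uE wE.
  move=> x y a b d e uE wE.
  rewrite !mulrDr -!scalerAr !scalerDr opprD addrACA.
  by rewrite !scalerA ![_ * c]mulrC -!scalerA -scalerBr; exact: (memv_lin _ uE wE).
have w1 := subvP (@V1_deg1 n) _ wV.
rewrite !colsum_mul //=.
(* Here w is the first factor of the product and u the rest. Moving v past w costs a sign and leaves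
   [I1] and [I2], which are the induction hypothesis for v and u at k and at k - 1 ([I2] being 0
   when k = 0). One copy of each mixed product remains, and these form [R]. *)
pose R := xlin v * ylin w + xlin w * ylin v.
pose I1 : EE := k.+1%:R *: (xlin v * colsum k.+1 u) - (p%:R - k%:R) *: (ylin v * colsum k u).
pose I2 : EE := k%:R *: (xlin v * colsum k u) -
  (p.+1%:R - k%:R) *: (ylin v * colword_pred (fun k => colsum k u) k).
have I2D : I2 \in swapI p.+1.
  rewrite /I2; clear I1 I2; case: k => [|k] /=.
    by rewrite mulr0 scaler0 scale0r subr0 mem0v.
  have -> : p.+1%:R - k.+1%:R = p%:R - k%:R :> rat by rewrite -!natr1; ring.
  exact: IH.
suff -> : k.+1%:R *: (xlin v * (xlin w * colsum k.+1 u + ylin w * colsum k u)) -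
   (p.+1%:R - k%:R) *:
     (ylin v * (xlin w * colsum k u + ylin w * colword_pred (fun k => colsum k u) k)) =
   R * colsum k u - xlin w * I1 - ylin w * I2.
  apply: memvB; last exact: swapI_mul (ylin_Vdiff wV) I2D.
  apply: memvB; last exact: swapI_mul (xlin_Vdiff wV) (IH k v u vV uV).
  exact: (memv_mul (xlin_ylin_sym vV wV) (colsum_Vdiffp k uV)).
have xx : xlin v * xlin w = - (xlin w * xlin v).
  by apply: deg1_anticomm; apply: (subvP (@Vdiff_deg1 n)); apply: xlin_Vdiff.
have yy : ylin v * ylin w = - (ylin w * ylin v).
  by apply: deg1_anticomm; apply: (subvP (@Vdiff_deg1 n)); apply: ylin_Vdiff.
have yx := XXY v w vV wV; have y'x := XXY w v wV vV.
rewrite /R /I1 /I2; move: (colword_pred _ _) (colsum k u) (colsum k.+1 u) => a b c.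
move: (xlin v) (xlin w) (ylin v) (ylin w) xx yy yx y'x => x x' y y' xx yy yx y'x.
rewrite !(mulrDr, mulrN) -!scalerAr !mulrA mulrDl xx yy yx y'x !mulNr -!natr1.
exact: swap_identity.
Qed.

(** Modulo [swapI] all colourings with k.+1 letters y agree, and the first factor is coloured y in a
    proportion 'C(p, k) / 'C(p.+1, k.+1) = k.+1 / p.+1 of them. The proportion for x in
    [xlin_colsum] arises in the same way. *)
Lemma ylin_colsum p k v w : v \in V1 -> w \in (V1 ^+ p)%VS ->
  exists2 d, d \in swapI p.+1 &
    ylin v * colsum k w = d + colsum k.+1 ((k.+1%:R / p.+1%:R) *: (v * w)).
Proof.
move=> vV wV.
exists (- (p.+1%:R^-1 *:
  (k.+1%:R *: (xlin v * colsum k.+1 w) - (p%:R - k%:R) *: (ylin v * colsum k w)))).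
  by rewrite memvN memvZ ?XY_swap.
rewrite [colsum k.+1 (_ *: _)]linearZ /= colsum_mul ?(subvP (@V1_deg1 n)) //=.
have := Num.Theory.pnatr_eq0 rat p.+1; rewrite -!natr1.
move: (xlin v * _) (ylin v * _) (p%:R : rat) (k%:R : rat) => e f P K /negbT P0.
exact: colour_identityY.
Qed.

Lemma xlin_colsum p k v w : v \in V1 -> w \in (V1 ^+ p)%VS ->
  exists2 d, d \in swapI p.+1 &
    xlin v * colsum k w = d + colsum k (((p.+1%:R - k%:R) / p.+1%:R) *: (v * w)).
Proof.
move=> vV wV; case: k => [|k].
  exists 0; first exact: mem0v.
  rewrite add0r subr0 divff ?Num.Theory.pnatr_eq0 // scale1r.
  by rewrite colsum_mul ?(subvP (@V1_deg1 n)) //= mulr0 addr0.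
exists (p.+1%:R^-1 *:
  (k.+1%:R *: (xlin v * colsum k.+1 w) - (p%:R - k%:R) *: (ylin v * colsum k w))).
  by rewrite memvZ ?XY_swap.
rewrite [colsum k.+1 (_ *: _)]linearZ /= colsum_mul ?(subvP (@V1_deg1 n)) //=.
have := Num.Theory.pnatr_eq0 rat p.+1; rewrite -!natr1.
move: (xlin v * _) (ylin v * _) (p%:R : rat) (k%:R : rat) => e f P K /negbT P0.
exact: colour_identityX.
Qed.

Definition colspan p : {vspace EE} := (\sum_(k < p.+1) (linfun (@colsum n k) @: (V1 ^+ p)))%VS.

Lemma colsum_colspan p k w : (k <= p)%N -> w \in (V1 ^+ p)%VS -> colsum k w \in colspan p.
Proof.
rewrite -ltnS => ltkp wV; apply: (subvP (sumv_sup (Ordinal ltkp) _ (subvv _))) => //.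
by rewrite -[colsum k w](lfunE (colsum k)) memv_img.
Qed.

(** Induction on p: a new generator is v x or v y with v in V(1), and by [xlin_colsum] and
    [ylin_colsum] its product with a colour sum is again a colour sum modulo [swapI]. *)
Lemma Vdiffp_decomp p : (Vdiff ^+ p = swapI p + colspan p)%VS.
Proof.
apply/eqP; rewrite eqEsubv; apply/andP; split; last first.
  rewrite subv_add swapI_Vdiffp; apply/subv_sumP => k _; apply/subvP => _ /memv_imgP[w wV ->].
  by rewrite lfunE colsum_Vdiffp.
elim: p => [|p IH].
  rewrite expv0 -memvE; apply: (subvP (addvSr _ _)).
  by have := @colsum_colspan 0 0 1; rewrite colsum_one; apply; rewrite ?expv0 ?memv_line.
rewrite expvSl; apply/prodvP => u u' uV /(subvP IH).
case/memv_addP => d dD [_ /memv_sumP[f fV ->] ->]; rewrite mulrDr memvD //.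
  by apply: (subvP (addvSl _ _)); apply: swapI_mul.
rewrite mulr_sumr; apply: memv_suml => k _.
have /memv_imgP[w wV ->] := fV k isT; rewrite lfunE /=.
have lekp : (k <= p)%N by rewrite -ltnS.
move: u uV; apply: span_ind => [|c u v uE vE|u].
- by rewrite mul0r mem0v.
- by rewrite mulrDl -scalerAl; exact: (memv_lin _ uE vE).
rewrite mem_cat => uX.
have [v vV uE] : exists2 v, v \in V1 & (u = xlin v) \/ (u = ylin v).
  case/orP: uX => /mapP[[i j] _ ->]; exists (eg i - eg j); rewrite ?linearB /= ?xlin_eg ?ylin_eg.
  - by apply/memv_span/allpairsP; exists (i, j); rewrite !mem_enum.
  - by left.
  - by apply/memv_span/allpairsP; exists (i, j); rewrite !mem_enum.
  by right.
have vwV c : c *: (v * w) \in (V1 ^+ p.+1)%VS by rewrite memvZ // expvSl memv_mul.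
by case: uE => ->;
  [have [d' d'D ->] := xlin_colsum k vV wV|have [d' d'D ->] := ylin_colsum k vV wV];
  apply: memv_add => //; apply: colsum_colspan; rewrite // ltnW.
Qed.

Lemma d2e_Vdiffp k u : u \in (Vdiff ^+ k)%VS -> d2e u = 0.
Proof. by move=> /(subvP (Vdiffp_Vbideg n k))/d2e_Vbideg0. Qed.

(** An explicit primitive: q_ij u = d_2(omega_ij u), because d_2 u = 0 for u in a power of
    [Vdiff]. *)
Lemma swapI_E3bd p : (swapI p <= E3bd n p 0)%VS.
Proof.
case: p => [|[|p]]; rewrite ?sub0v //; apply: subv_trans (addvSl _ _); rewrite subn2 /=.
apply/prodvP => q u; move: q; apply: span_ind => [|c q r qE rE uV|_ /mapP[[i j] ij ->] uV].
- by rewrite mul0r mem0v.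
- by rewrite mulrDl -scalerAl; exact: (memv_lin _ (qE uV) (rE uV)).
move: ij; rewrite mem_filter /= => /andP[nij _].
have -> : q2 i j * u = d2f n (Om i j * u).
  by rewrite lfunE /= [RHS]d2e_mul ?Om_deg1 // d2e_Om // (d2e_Vdiffp uV) mulr0 subr0.
apply: memv_img; rewrite memv_cap; apply/andP; split.
  apply: (subvP (addvSl _ _)); apply: (subvP (expv_subalg p.+1 (@gensA_deg1 n))).
  by rewrite expvSl memv_mul ?Om_gensA // (subvP (expvS p (@Vdiff_gensA n))).
exact: (Vbideg_mul (Om_Vbideg i j) (subvP (Vdiffp_Vbideg n p) _ uV)).
Qed.

Lemma E3bd_sub p u : u \in E3bd n p 0 -> u \in (Vdiff ^+ p)%VS /\ phi u = 0.
Proof.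
rewrite /E3bd Ipq0 addv0.
case: p => [|[|p]] /=; try by rewrite memv0 => /eqP->; rewrite mem0v linear0.
rewrite subn2 /= => /memv_imgP[r rE ->]; rewrite lfunE /=; split; first exact: d2f_E2lift.
exact: phi_d2e.
Qed.

End ColourSwap.

(** * The coboundaries as the kernel of phi, and the dimension count *)

Section Coboundaries.
Variable n : nat.
Notation EE := (ealg (gen n)).
Notation VV := (ealg 'I_n).
Implicit Types (i j : 'I_n) (u : EE) (v w : VV).
Notation Vdiff := (Vdiff n).
Notation V1 := (V1 n).
Notation Vq2 := (Vq2 n).
Notation swapI := (swapI n).

Notation colspan := (@colspan n).

Lemma mnm2_inj p k l : mnm2 p k = mnm2 p l -> k = l.
Proof. by move/mnmP/(_ ord_max); rewrite !mnmE. Qed.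

(** Distinct k give distinct monomials, so the coefficient at [mnm2 p k] isolates 'C(p, k) times f
    k, and the binomial is non-zero because k <= p. *)
Lemma phi_Fsum0 p (f : 'I_p.+1 -> VV) : (forall k, f k \in (V1 ^+ p)%VS) ->
  phi (\sum_(k < p.+1) colsum k (f k)) = 0 -> forall k, f k = 0.
Proof.
move=> fV; rewrite linear_sum /= => f0 k; apply/ffunP=> A.
move/ffunP/(_ A): f0; rewrite sum_ffunE => /(congr1 (mcoeff (mnm2 p k))).
rewrite linear_sum (bigD1 k) //= big1 ?addr0 => [|l nlk].
  rewrite (phi_colsum _ (fV k)) !ffunE scalerA mcoeffZ mcoeffX eqxx mcoeff0 mulr1 => /eqP.
  by rewrite mulf_eq0 Num.Theory.pnatr_eq0 -leqn0 leqNgt bin_gt0 -ltnS ltn_ord /= => /eqP.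
rewrite (phi_colsum _ (fV l)) !ffunE scalerA mcoeffZ mcoeffX.
by case: eqP => [/mnm2_inj/val_inj lk|_]; [rewrite lk eqxx in nlk | rewrite mulr0].
Qed.

Lemma colspan_P p u : u \in colspan p -> exists2 f : 'I_p.+1 -> VV,
  forall k, f k \in (V1 ^+ p)%VS & u = \sum_(k < p.+1) colsum k (f k).
Proof.
case/memv_sumP => f fV ->.
have g k : {w | w \in (V1 ^+ p)%VS & f k == colsum k w}.
  apply: sig2W; have /memv_imgP[w wV ->] := fV k isT; exists w => //; apply/eqP; exact: lfunE.
exists (fun k => s2val (g k)) => [k|]; first exact: (s2valP (g k)).
by apply: eq_bigr => k _; exact/eqP/(s2valP' (g k)).
Qed.

Lemma E3bd_ker p u : u \in (Vdiff ^+ p)%VS -> phi u = 0 -> u \in E3bd n p 0.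
Proof.
rewrite (Vdiffp_decomp n p) => /memv_addP[d dD [s /colspan_P[f fV ->] ->]].
have dB := subvP (swapI_E3bd n p) _ dD; have [_ d0] := E3bd_sub dB.
rewrite linearD /= d0 add0r => /(phi_Fsum0 fV) f0.
by rewrite big1 ?addr0 // => k _; rewrite f0 linear0.
Qed.

Lemma dim_E3 p : \dim (Vdiff ^+ p) = (\dim (E3bd n p 0) + p.+1 * \dim (V1 ^+ p))%N.
Proof.
have -> : (Vdiff ^+ p)%VS = (E3bd n p 0 + colspan p)%VS.
  apply/eqP; rewrite eqEsubv subv_add; apply/and3P; split.
  - by rewrite Vdiffp_decomp; apply: addvS => //; apply: swapI_E3bd.
  - by apply/subvP => u /E3bd_sub[].
  by rewrite Vdiffp_decomp addvSr.
rewrite dimv_disjoint_sum; last first.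
  apply/eqP; rewrite -subv0; apply/subvP => u; rewrite memv_cap => /andP[/E3bd_sub[_ u0]].
  case/colspan_P => f fV uE; move: u0; rewrite uE => /(phi_Fsum0 fV) f0.
  by rewrite big1 ?mem0v // => k _; rewrite f0 linear0.
congr (_ + _)%N; rewrite /colspan.
rewrite (directvP _) /=; last first.
  apply/directv_sum_independent => f fV s0 k _.
  have g l : {w | w \in (V1 ^+ p)%VS & f l == colsum l w}.
    apply: sig2W; have /memv_imgP[w wV ->] := fV l isT; exists w => //; apply/eqP; exact: lfunE.
  rewrite (eqP (s2valP' (g k))) (phi_Fsum0 (f := fun k => s2val (g k))) ?linear0 //.
    by move=> l; exact: (s2valP (g l)).
  rewrite -[RHS](linear0 (@phi n)); congr (phi _); rewrite -[RHS]s0.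
  by apply: eq_bigr => l _; exact/esym/eqP/(s2valP' (g l)).
rewrite (eq_bigr (fun=> \dim (V1 ^+ p))) ?sum_nat_const ?card_ord // => k _.
apply: limg_dim_eq; apply/eqP; rewrite -subv0; apply/subvP => w.
rewrite memv_cap memv_ker lfunE /= => /andP[wV /eqP w0].
(* The family concentrated at k turns the joint independence into injectivity of the single map
   [colsum k]. *)
have := @phi_Fsum0 p (fun l => if l == k then w else 0).
rewrite (bigD1 k) //= eqxx big1 ?addr0 => [|l /negbTE->]; last exact: linear0.
rewrite w0 linear0 => /(_ _ erefl k); rewrite eqxx => -> //; first exact: mem0v.
by move=> l; case: ifP; rewrite ?mem0v.
Qed.

End Coboundaries.

Lemma ealg_ind (G : finType) (P : ealg G -> Prop) :
    P 0 -> (forall c u v, P u -> P v -> P (c *: u + v)) ->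
    (forall s, P (wprod eg s)) ->
  forall v, P v.
Proof.
move=> P0 Plin Pw v; rewrite [v]ext_sum_eb.
elim/big_rec: _ => // A u _; apply: Plin; rewrite -eb_wprod; exact: Pw.
Qed.

(** * Exterior powers of V(1) *)

Section Dimension.
Variable m : nat.
Notation VV := (ealg 'I_m.+1).
Notation V1 := (V1 m.+1).
Implicit Types (i j : 'I_m.+1) (u v w : VV) (A B : {set 'I_m.+1}).

Lemma free_eb (s : seq {set 'I_m.+1}) : uniq s -> free ([seq (eb A : VV) | A <- s]).
Proof.
elim: s => [|A s IH] /=; first by rewrite nil_free.
case/andP=> nAs us; rewrite free_cons IH // andbT; apply/negP => As.
have: (eb A : VV) A = 0.
  move: (eb A : VV) As; apply: span_ind => [|c u v u0 v0|_ /mapP[B Bs ->]].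
  - by rewrite ffunE.
  - by rewrite !ffunE u0 v0 scaler0 addr0.
  by rewrite ffunE; case: eqP Bs nAs => // -> ->.
by rewrite ffunE eqxx => /eqP; rewrite oner_eq0.
Qed.

Definition nz_sets p := enum [set A : {set 'I_m.+1} | A \subset [set~ ord0] & #|A| == p].

Definition Sp p : {vspace VV} := <<[seq (eb A : VV) | A <- nz_sets p]>>%VS.

Lemma dim_Sp p : \dim (Sp p) = 'C(m, p).
Proof.
rewrite (eqP (free_eb (enum_uniq _))) size_map -cardE cards_draws.
by rewrite cardsC1 card_ord.
Qed.

Lemma eg_Sp p i u : i != ord0 -> u \in Sp p -> eg i * u \in Sp p.+1.
Proof.
move=> ni0; move: u; apply: span_ind => [|c u v u1 v1|_ /mapP[A As ->]].
- by rewrite mulr0 mem0v.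
- by rewrite mulrDr -scalerAr; exact: (memv_lin _ u1 v1).
rewrite [_ * _]xb_mul; case: ifPn => [|_]; last exact: mem0v.
rewrite setI_eq0 disjoints1 => niA; apply/memvZ/memv_span/(map_f (@eb _)).
move: As; rewrite !mem_enum !inE => /andP[sA0 /eqP cA].
rewrite cardsU1 niA cA eqxx andbT subUset sA0 andbT sub1set !inE //.
Qed.

(** The parameter c makes the inverse an instance of the same construction, with - c ([ShK]). *)
Definition shear (c : rat) i : VV := if i == ord0 then eg i else eg i + c *: eg ord0.

Lemma shear_deg1 c i : shear c i \in deg1.
Proof.
rewrite /shear; case: ifP => _; first exact: eg_deg1.
by apply: memvD; [exact: eg_deg1|apply: memvZ; exact: eg_deg1].
Qed.

Lemma shear_anticomm c : anticomm (shear c).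
Proof. by move=> i j; apply: deg1_anticomm; apply: shear_deg1. Qed.

(* For c = -1 this automorphism carries the exterior powers of the span of the e_i,
   i != 0, onto those of V(1). *)
Definition shearm c : VV -> VV := lext (wprod (shear c)).
HB.instance Definition _ c := GRing.Linear.copy (shearm c) (lext (wprod (shear c))).

Lemma shearm_lin c a u v : shearm c (a *: u + v) = a *: shearm c u + shearm c v.
Proof. exact: linearP. Qed.

Lemma shearm_mul c u v : shearm c (u * v) = shearm c u * shearm c v.
Proof. exact: lext_mul (@shear_anticomm c) u v. Qed.

Lemma shearm_eg c i : shearm c (eg i) = shear c i.
Proof. exact: lext_eg (@shear_anticomm c) i. Qed.

Lemma shearm_wprod c s : shearm c (wprod eg s) = wprod (shear c) s.
Proof. by apply: lext_word; apply/alt_wprod/shear_anticomm. Qed.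

Lemma ShK c : cancel (shearm c) (shearm (- c)).
Proof.
apply: ealg_ind => [|a u v uE vE|s]; first by rewrite !linear0.
  by rewrite !shearm_lin uE vE.
rewrite shearm_wprod; elim: s => [|i s IH].
  by rewrite /wprod !big_nil; exact: lext_one (@shear_anticomm _).
rewrite /wprod !big_cons shearm_mul -/(wprod _ _) IH; congr (_ * _).
rewrite /shear; case: (eqVneq i ord0) => [->|/negbTE ni0]; first by rewrite shearm_eg /shear eqxx.
by rewrite linearD linearZ /= !shearm_eg /shear eqxx ni0 scaleNr subrK.
Qed.

(** The value 0 at [ord0] makes the preimage of e_i - e_0 under the shear uniform in i, so that e_i
    - e_j lifts to [ev0 i - ev0 j] without distinguishing cases. *)
Definition ev0 i : VV := if i == ord0 then 0 else eg i.

Lemma shearm_ev0 i : shearm (-1) (ev0 i) = eg i - eg ord0.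
Proof.
rewrite /ev0; case: (eqVneq i ord0) => [->|ni0]; first by rewrite linear0 subrr.
by rewrite shearm_eg /shear (negbTE ni0) scaleN1r.
Qed.

Lemma V1_shear p : (linfun (shearm (-1)) @: Sp p = V1 ^+ p)%VS.
Proof.
apply/eqP; rewrite eqEsubv; apply/andP; split.
  rewrite limg_span; apply/span_subvP => _ /mapP[_ /mapP[A As ->] ->].
  rewrite lfunE /= -eb_wprod shearm_wprod.
  move: As; rewrite mem_enum inE => /andP[sA0 /eqP <-]; rewrite cardE.
  have: {subset enum A <= [set~ ord0]} by move=> i; rewrite mem_enum; apply/subsetP.
  elim: (enum A) => [|i s IH] sis /=; first by rewrite /wprod big_nil; exact: memv_line.
  rewrite /wprod big_cons expvSl; apply: memv_mul; last first.
    by apply: IH => j js; apply: sis; rewrite inE js orbT.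
  have := sis i (mem_head _ _); rewrite !inE /shear => /negbTE ->; rewrite scaleN1r.
  by apply/memv_span/allpairsP; exists (i, ord0); rewrite !mem_enum.
elim: p => [|p IH].
  rewrite expv0 -memvE -[1](lext_one (@shear_anticomm (-1))) -[lext _ _](lfunE (shearm (-1))).
  apply: memv_img; apply/memv_span/(map_f (@eb _)).
  by rewrite mem_enum !inE cards0 sub0set.
rewrite expvSl; apply/prodvP => v u v1 /(subvP IH)/memv_imgP[w wS ->]; rewrite lfunE /=.
move: v v1; apply: V1_ind => [|c u' v u1 v1|i j].
- by rewrite mul0r mem0v.
- by rewrite mulrDl -scalerAl; exact: (memv_lin _ u1 v1).
have -> : eg i - eg j = shearm (-1) (ev0 i - ev0 j).
  by rewrite linearB /= !shearm_ev0 opprB addrA subrK.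
rewrite -shearm_mul -[shearm _ _](lfunE (shearm (-1))); apply: memv_img.
rewrite mulrBl; apply: memvB; rewrite /ev0;
  case: (eqVneq _ ord0) => [_|ni0]; first [by rewrite mul0r mem0v | exact: eg_Sp].
Qed.

Lemma dim_V1 p : \dim (V1 ^+ p) = 'C(m, p).
Proof.
rewrite -V1_shear limg_dim_eq ?dim_Sp //; apply/eqP; rewrite -subv0.
apply/subvP => v; rewrite memv_cap memv_ker lfunE /= => /andP[_ /eqP v0].
by rewrite -[v](ShK (-1)) v0 linear0 mem0v.
Qed.

End Dimension.

(** * Image of phi, and the action on generators *)

Section Isomorphism.
Variables n p : nat.
Notation EE := (ealg (gen n)).
Notation VV := (ealg 'I_n).
Notation TT := (xalg {mpoly rat[2]} 'I_n).

Lemma mdeg_mnm2 k : (k <= p)%N -> mdeg (mnm2 p k) = p.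
Proof. by move=> lekp; rewrite mdegE !big_ord_recl big_ord0 !mnmE /= addn0 subnK. Qed.

Lemma inTgt_phi (u : EE) : u \in (Vdiff n ^+ p)%VS -> inTgt p (phi u).
Proof.
rewrite Vdiffp_decomp => /memv_addP[d /(subvP (swapI_E3bd n p))/E3bd_sub[_ d0]].
case=> s /colspan_P[f fV ->] ->.
exists [seq ('C(p, val k)%:R *: f k, mon p (val k)) | k <- enum 'I_p.+1]; split.
- by apply/allP => _ /mapP[k _ ->] /=; rewrite LamV1E memvZ.
- apply/allP => _ /mapP[k _ ->] /=.
  by rewrite dhomogX; apply/eqP/mdeg_mnm2; rewrite -ltnS.
rewrite linearD /= d0 add0r linear_sum big_map big_enum; apply: eq_bigr => k _ /=.
by rewrite (phi_colsum _ (fV k)) -tenZl.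
Qed.

Lemma homog2E (P : {mpoly rat[2]}) : P \is p.-homog ->
  P = \sum_(k < p.+1) P@_(mnm2 p k) *: mon p k.
Proof.
move=> homP; apply/mpolyP => m; rewrite linear_sum /=.
have [dm|ndm] := eqVneq (mdeg m) p; last first.
  rewrite (dhomog_nemf_coeff homP ndm) big1 // => k _.
  rewrite mcoeffZ mcoeffX; case: eqP => [mE|_]; last by rewrite mulr0.
  by case/eqP: ndm; rewrite -mE mdeg_mnm2 // -ltnS.
have dm2 : (m ord0 + m ord_max)%N = p.
  rewrite -dm mdegE !big_ord_recl big_ord0 addn0.
  by congr (_ + fun_of_multinom m _)%N; apply: val_inj.
have lt_m : (m ord_max < p.+1)%N by rewrite ltnS -dm2 leq_addl.
have mE : mnm2 p (Ordinal lt_m) = m.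
  apply/mnmP => i; rewrite mnmE /=; case: eqP => [->|]; first by rewrite -{1}dm2 addnK.
  move/eqP; rewrite -val_eqE; case: i => [[|[|i]]] //= lti _.
  by congr (fun_of_multinom m _); apply: val_inj.
rewrite (bigD1 (Ordinal lt_m)) //= big1 ?addr0 => [|k nk]; rewrite mcoeffZ mcoeffX.
  by rewrite mE eqxx mulr1.
case: eqP => [kE|_]; last by rewrite mulr0.
by case/eqP: nk; apply/val_inj/(@mnm2_inj p); rewrite kE mE.
Qed.

Lemma phi_onto (F : Tgt n) : inTgt p F -> exists2 u : EE, u \in (Vdiff n ^+ p)%VS & phi u = F.
Proof.
case=> s [sL sH ->]; elim: s sL sH => [_ _|[w P] s IH /= /andP[wL sL] /andP[PH sH]].
  by exists 0; rewrite ?mem0v // linear0 big_nil.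
have [u uV uE] := IH sL sH; rewrite big_cons -uE.
rewrite LamV1E in wL.
(* The division cancels the factor 'C(p, k) of [phi_colsum]. *)
pose c k : rat := P@_(mnm2 p k) / 'C(p, k)%:R.
exists (\sum_(k < p.+1) colsum k (c k *: w) + u).
  by apply: memvD => //; apply: memv_suml => k _; apply/colsum_Vdiffp/memvZ.
rewrite linearD; congr (_ + _); rewrite linear_sum [in RHS](homog2E PH).
rewrite -[RHS]/(ten w _); elim/big_rec2: _ => [|k Q Q' _ IHQ]; first by rewrite ten0r.
rewrite /= tenDr -IHQ (phi_colsum _ (memvZ _ wL)) tenZl scalerA tenZr; congr (_ *: _ + _).
rewrite /c mulrC divfK // Num.Theory.pnatr_eq0 -lt0n bin_gt0 -ltnS; exact: ltn_ord.
Qed.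

Variables (s : 'S_n) (g : 'M[rat]_2).

Let pg (a : gen n) : EE := perm_gen s a.
Let sg (a : gen n) : EE := sl2_gen g a.
Let permact : EE -> EE := lext (wprod pg).
Let sl2act : EE -> EE := lext (wprod sg).

Lemma perm_gen_anticomm : anticomm pg.
Proof.
move=> a b; apply: deg1_anticomm; [move: a|move: b];
  by move=> [[i|i]|w]; [exact: eg_deg1|exact: eg_deg1|exact: Om_deg1].
Qed.

Lemma sl2_gen_deg1 a : sg a \in deg1.
Proof.
case: a => [[i|i]|w]; last exact: eg_deg1;
by apply: memvD; apply: memvZ; exact: eg_deg1.
Qed.

Lemma sl2_gen_anticomm : anticomm sg.
Proof. by move=> a b; apply: deg1_anticomm; exact: sl2_gen_deg1. Qed.

Lemma actE_comp v : actE s g v = permact (sl2act v).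
Proof. by rewrite /actE !algmapE. Qed.

Lemma actE_lin c (u v : EE) : actE s g (c *: u + v) = c *: (actE s g u : EE) + actE s g v :> EE.
Proof. by rewrite !actE_comp /sl2act linearP /permact linearP. Qed.

Lemma actE_mul (u v : EE) : actE s g (u * v) = (actE s g u : EE) * actE s g v :> EE.
Proof.
rewrite !actE_comp [sl2act _](lext_mul sl2_gen_anticomm) [LHS](lext_mul perm_gen_anticomm) //.
Qed.

Lemma actE_one : actE s g (1 : EE) = 1 :> EE.
Proof.
by rewrite actE_comp [sl2act _](lext_one sl2_gen_anticomm) [LHS](lext_one perm_gen_anticomm).
Qed.

Let permact_eg a : permact (eg a) = pg a.
Proof. exact: lext_eg perm_gen_anticomm a. Qed.

Let PmP c (u v : EE) : permact (c *: u + v) = c *: permact u + permact v.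
Proof. exact: linearP. Qed.

Let PmZ c (u : EE) : permact (c *: u) = c *: permact u.
Proof. exact: linearZ. Qed.

Lemma actE_X i : actE s g (X i) = g 0 0 *: X (s i) + g 1 0 *: Y (s i) :> EE.
Proof.
rewrite actE_comp [sl2act _](lext_eg sl2_gen_anticomm) -[sg _]/(g 0 0 *: X i + g 1 0 *: Y i).
by rewrite PmP PmZ (permact_eg (inl (inl i))) (permact_eg (inl (inr i))).
Qed.

Lemma actE_Y i : actE s g (Y i) = g 0 1 *: X (s i) + g 1 1 *: Y (s i) :> EE.
Proof.
rewrite actE_comp [sl2act _](lext_eg sl2_gen_anticomm) -[sg _]/(g 0 1 *: X i + g 1 1 *: Y i).
by rewrite PmP PmZ (permact_eg (inl (inl i))) (permact_eg (inl (inr i))).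
Qed.

Lemma phi_actE_Om w : phi (actE s g (eg (inr w))) = 0.
Proof.
rewrite actE_comp [sl2act _](lext_eg sl2_gen_anticomm) [permact _](permact_eg (inr w)).
exact: phi_Om.
Qed.

Lemma actE_Vdiff u : u \in Vdiff n -> (actE s g u : EE) \in Vdiff n.
Proof.
have actB (u' v : EE) : actE s g (u' - v) = (actE s g u' : EE) - actE s g v :> EE.
  by rewrite -scaleN1r addrC actE_lin scaleN1r addrC.
have comb (a b : rat) i j :
    (a *: X (s i) + b *: Y (s i) : EE) - (a *: X (s j) + b *: Y (s j)) \in Vdiff n.
  rewrite opprD addrACA -!scalerBr; apply: memvD; apply: memvZ; [exact: X_Vdiff|exact: Y_Vdiff].
move: u; apply: span_ind => [|c u v u1 v1|u].
- by rewrite actE_comp /sl2act linear0 /permact linear0 mem0v.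
- rewrite actE_lin; exact: (memv_lin _ u1 v1).
rewrite mem_cat => /orP[] /mapP[[i j] _ ->] /=; rewrite actB ?actE_X ?actE_Y; exact: comb.
Qed.

End Isomorphism.

(** * Equivariance *)

Section Equivariance.
Variables (n : nat) (s : 'S_n) (g : 'M[rat]_2).
Notation EE := (ealg (gen n)).
Notation VV := (ealg 'I_n).
Notation TT := (xalg {mpoly rat[2]} 'I_n).

Lemma actE_Vdiffp p (u : EE) : u \in (Vdiff n ^+ p)%VS -> (actE s g u : EE) \in (Vdiff n ^+ p)%VS.
Proof.
elim: p u => [|p IH] u.
  rewrite expv0 => /vlineP[c ->]; rewrite -[c *: 1]addr0 actE_lin actE_one.
  by rewrite actE_comp /= !linear0 addr0 memvZ ?memv_line.
rewrite expvSl; move: u; apply: prodv_ind => [|c u v u1 v1|u v u1 vp].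
- by rewrite actE_comp /= !linear0 mem0v.
- rewrite actE_lin; exact: (memv_lin _ u1 v1).
rewrite actE_mul; exact: (memv_mul (actE_Vdiff s g u1) (IH v vp)).
Qed.

Let sigma : VV -> VV := algmap (fun i => egen (s i)).

Lemma eg_perm_anticomm : anticomm (fun i => eg (s i)).
Proof. by move=> i j; apply: eg_anticomm. Qed.

Lemma sigmaE v : sigma v = lext (wprod (fun i => eg (s i))) v.
Proof. exact: algmapE. Qed.

Lemma sigma_mul v w : sigma (v * w) = sigma v * sigma w.
Proof. by rewrite !sigmaE [LHS](lext_mul eg_perm_anticomm). Qed.

Lemma actT_lin c (F F' : TT) :
  actT s g (c *: F + F') = c *: (actT s g F : TT) + actT s g F' :> TT.
Proof.
apply/ffunP=> C; rewrite !ffunE scaler_sumr -big_split; apply: eq_bigr => A _ /=.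
by rewrite !ffunE /sl2_poly linearP scalerDr !scalerA mulrC.
Qed.

Lemma actT0 : actT s g (0 : TT) = 0 :> TT.
Proof.
apply/ffunP=> C; rewrite !ffunE big1 // => A _.
by rewrite ffunE /sl2_poly linear0 scaler0.
Qed.

Lemma actT_ten v P : actT s g (ten v P) = ten (sigma v) (sl2_poly g P) :> TT.
Proof.
apply/ffunP=> C; rewrite !ffunE [v in RHS]ext_sum_eb /sigma.
have -> : algmap (fun i => egen (s i)) (\sum_A v A *: eb A) =
    \sum_A v A *: algmap (fun i => egen (s i)) (eb A) :> ext 'I_n.
  by rewrite /algmap linear_sum; apply: eq_bigr => A _; rewrite linearZ.
rewrite sum_ffunE scaler_suml; apply: eq_bigr => A _.
by rewrite !ffunE /sl2_poly linearZ /= !scalerA mulrC.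
Qed.

Lemma phi_equivariant (u : EE) : phi (actE s g u) = actT s g (phi u) :> TT.
Proof.
move: u; apply: ealg_ind => [|c u v uE vE|w].
- by rewrite actE_comp /= !linear0 actT0.
- by rewrite actE_lin !linearP /= uE vE actT_lin.
(* The image of a word is a pure tensor, on which [actT] acts factor by factor ([actT_ten]);
   carrying the two tensor factors through the induction reduces equivariance to single letters. *)
have [v [P [-> ->]]] : exists v P, phi (wprod eg w) = ten v P /\
    phi (actE s g (wprod eg w)) = ten (sigma v) (sl2_poly g P).
  elim: w => [|a w [v [P [vP svP]]]].
    exists 1, 1; rewrite /wprod big_nil actE_one !phi_one ten_one; split=> //.
    by rewrite sigmaE (lext_one eg_perm_anticomm) /sl2_poly rmorph1 ten_one.
  have sig_eg i : sigma (eg i) = eg (s i).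
    by rewrite sigmaE; apply: (lext_eg eg_perm_anticomm).
  have wE : wprod eg (a :: w) = eg a * wprod eg w by rewrite /wprod big_cons.
  rewrite wE actE_mul !phi_mul vP svP.
  case: a {wE} => [[i|i]|a].
  - exists (eg i * v), ('X_ord0 * P); rewrite phi_eg ten_mul; split=> //.
    rewrite (actE_X s g i) linearD !linearZ /= phi_X phi_Y -!tenZr -tenDr ten_mul.
    rewrite sigma_mul sig_eg /sl2_poly rmorphM /=; congr (ten _ (_ * _)).
    by rewrite comp_mpolyXU.
  - exists (eg i * v), ('X_ord_max * P); rewrite phi_eg ten_mul; split=> //.
    rewrite (actE_Y s g i) linearD !linearZ /= phi_X phi_Y -!tenZr -tenDr ten_mul.
    rewrite sigma_mul sig_eg /sl2_poly rmorphM /=; congr (ten _ (_ * _)).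
    by rewrite comp_mpolyXU.
  exists 0, 0; rewrite phi_eg /= phi_actE_Om !mul0r ten0l /sl2_poly linear0 ten0r; split => //.
by rewrite actT_ten.
Qed.

End Equivariance.

(* E_3^{p,0}(n,E) = E3cyc n p 0 / E3bd n p 0.  The isomorphism of          *)
(* S_n x SL_2(Q)-representations E_3^{p,0}(n,E) ~= /\^p V(1) [x] V_p is    *)
(* given by a linear map phi defined on the cocycles, onto the target, with *)
(* kernel exactly the coboundaries, and equivariant.                        *)
Theorem theorem3p9 (n p : nat) : (1 <= n)%N ->
  ((E3bd n p 0 <= E3cyc n p 0)%VS /\
   (forall (s : 'S_n) (g : 'M[rat]_2), \det g = 1 ->
      (forall v, v \in E3cyc n p 0 -> actE s g v \in E3cyc n p 0) /\
      (forall v, v \in E3bd n p 0 -> actE s g v \in E3bd n p 0)) /\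
   exists phi : {linear E n -> Tgt n},
     [/\ forall v, v \in E3cyc n p 0 -> inTgt p (phi v),
         forall F, inTgt p F -> exists2 v, v \in E3cyc n p 0 & phi v = F,
         forall v, v \in E3cyc n p 0 -> (phi v = 0 <-> v \in E3bd n p 0)
       & forall (s : 'S_n) (g : 'M[rat]_2), \det g = 1 ->
           forall v, v \in E3cyc n p 0 -> phi (actE s g v) = actT s g (phi v)])
  /\ \dim (E3cyc n p 0) = (\dim (E3bd n p 0) + 'C(n.-1, p) * p.+1)%N.
Proof.
case: n => // m _; have cycE := E3cycE m.+1 p; set n := m.+1 in cycE *.
(* With the coboundaries described as a kernel, their stability under the group follows from the
   equivariance of [phi], and the action on lifts that contain an omega need not be examined. *)
have bdP v : v \in E3bd n p 0 <-> v \in (Vdiff n ^+ p)%VS /\ phi (v : ealg (gen n)) = 0.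
  by split=> [/E3bd_sub //|[vV v0]]; apply: E3bd_ker.
split; last by rewrite [in LHS]cycE dim_E3 dim_V1 mulnC.
rewrite cycE; split; first by apply/subvP => v /bdP[].
split=> [s g _|].
  split=> v; first exact: actE_Vdiffp.
  case/bdP=> vV v0; apply/bdP; split; first exact: actE_Vdiffp.
  by rewrite phi_equivariant v0 actT0.
exists (@phi n : {linear E n -> Tgt n}); split.
- by move=> v; apply: inTgt_phi.
- by move=> F /phi_onto[v vV vF]; exists v.
- move=> v vV; split=> [v0|/bdP[]//]; exact/bdP.
by move=> s g _ v _; apply: phi_equivariant.
Qed.
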